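(* Let $(Y_{i\,j})_{i,j\in\mathbb N}$ be independent identically distributed real random variables with $\mathbb E[Y_{1\,1}]=0$ and $\mathbb E[Y_{1\,1}^2]=1$. Fix $l\in\mathbb N$ and assume $\mathbb E[Y_{1\,1}^{2l}]<\infty$. For $p\le n$ let $\mathbf X_{p,n}=(Y_{i\,j})_{i\le p,\,j\le n}\in\mathbb R^{p\times n}$ and $\mathbf S_{p,n}=\frac1n\mathbf X_{p,n}\mathbf X_{p,n}^T$. Then for $p\le n$ \begin{align*} \mathbb E[\operatorname{tr}(\mathbf S_{p,n}^l)]=\sum_{b=1}^{l\wedge p}\Bigg[&\frac{\binom{p}{b}\binom{n-b}{l+1-b}}{n^l}\,l!\binom{l-1}{b-1}\\ &+\frac{\binom{p}{b}\binom{n-b}{l-b}}{n^l}\Bigg\{\frac{b!(l-b)!}{2}\Bigg(\binom{2l}{2b}+(2b-1)\binom{l}{b}^2\Bigg)\\ &\qquad+\big(\mathbb E[Y_{1\,1}^4]-3\big)\,\mathbb 1_{b<l}\,b!(l-b)!\binom{l}{b-1}\binom{l}{b+1}\Bigg\}+\mathcal O\Big(\frac{p^b}{n^{b+1}}\Big)\Bigg]. \end{align*}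
   Context: $a\wedge b=\min(a,b)$. For each $b$, the term $\mathcal O(p^b/n^{b+1})$ denotes a quantity whose absolute value is bounded by $C\,p^b/n^{b+1}$ for a constant $C$ not depending on $p,n$ (uniformly over $p\le n$). *)

(* Defs.v *)
From HB Require Import structures.
From mathcomp Require Import all_boot all_order all_algebra.
From mathcomp Require Import all_classical all_reals all_analysis.
Set Implicit Arguments. Unset Strict Implicit. Unset Printing Implicit Defensive.
Import Order.TTheory GRing.Theory Num.Theory.
Local Open Scope classical_set_scope.
Local Open Scope ring_scope.

Definition mutually_independent d (T : measurableType d) (R : realType)
    (P : probability T R) (I : eqType) (X : I -> T -> R) : Prop :=
  forall (J : seq I) (B : I -> set R),
    uniq J -> (forall i, measurable (B i)) ->
    P [set w | forall i, i \in J -> B i (X i w)] =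
    (\prod_(i <- J) P (X i @^-1` B i))%E.

Definition identically_distributed d (T : measurableType d) (R : realType)
    (P : probability T R) (I : Type) (X : I -> T -> R) (X0 : T -> R) : Prop :=
  forall i (B : set R), measurable B -> P (X i @^-1` B) = P (X0 @^-1` B).

Definition Xmat (T : Type) (R : realType) (Y : nat -> nat -> T -> R)
    (p n : nat) (w : T) : 'M[R]_(p, n) :=
  \matrix_(i < p, j < n) Y i j w.

Definition Smat (T : Type) (R : realType) (Y : nat -> nat -> T -> R)
    (p n : nat) (w : T) : 'M[R]_p :=
  n%:R^-1 *: (Xmat Y p n w *m (Xmat Y p n w)^T).

Definition trSl (T : Type) (R : realType) (Y : nat -> nat -> T -> R)
    (p n l : nat) (w : T) : R :=
  \tr (Smat Y p n w ^+ l).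

(* Main.v *)
Require Import Defs.
From HB Require Import structures.
From mathcomp Require Import all_boot all_order all_algebra.
From mathcomp Require Import all_classical all_reals all_analysis.
From mathcomp Require Import measurable_realfun.
From mathcomp Require Import ring lra zify.
Import Order.TTheory GRing.Theory Num.Theory.
Set Implicit Arguments. Unset Strict Implicit. Unset Printing Implicit Defensive.
Local Open Scope ring_scope.

(** Since [p <= n], the error sum in the theorem is of the exact order [p / n^2], so
    it is enough to expand [E tr (X X^T)^l] up to an error [O(p n^(l-2))].

    The monic polynomials [T_m] given by [T_m(x) = h^-m + (n p h)^m] when
    [x = (1 + n h)(1 + p h) / h] satisfy [x^l = Q(l,0) + sum_(m >= 1) Q(l,m) T_m(x)] with
    [Q(l,m)] the coefficient of [h^(l-m)] in [(1 + n h)^l (1 + p h)^l], so only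
    [E tr T_m(X X^T)] is needed.  Up to an explicit term, [tr T_m(X X^T)] is the sum over
    closed walks of length [2 m] on the complete bipartite graph [K_(p,n)] in which the
    immediate backtrackings (spikes) are removed by inclusion-exclusion, each removed
    spike having weight [E Y^2 = 1].  The expected weight of a walk vanishes if some edge
    is used once, or if a spike sits on an edge used exactly twice.  In every other walk
    each vertex is visited at least twice, so there are at most [m] vertices; walks with
    fewer than [m] vertices are negligible, and a walk with exactly [m] vertices visits
    each of them exactly twice, which forces it to run twice around a cycle of length
    [m], [m] even (a single edge run through four times when [m = 2]).  Hence
    [E tr T_m] is [(p n)^(m/2)] for even [m], plus [(E Y^4 - 3) p n] when [m = 2], up to
    the explicit term and a negligible error.  Summing over [m], Vandermonde's identity
    gives the coefficients of the theorem, after passing from powers of [p] and [n] to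
    binomial coefficients. *)

(** * Traces of powers as sums over closed walks *)

(** What hides the second order of [E tr (X X^T)^l] is backtracking: the dominant walks carry trees,
    and counting how trees combine with cycles is laborious. Giving a removed spike the weight 1 in
    place of [Y^2] makes them cancel in the mean, because [E (Y^2 - 1) = 0]. The same signed sum
    over walks with selected spikes is also algebraic: it is the trace of a power of the block
    matrix [[[x, -D], [1, 0]]], where [x] is the bipartite adjacency matrix weighted by [Y] and [D]
    is the diagonal matrix of degrees, [n] on the rows and [p] on the columns. As [x] exchanges the
    two sides, [D x = (n + p) x - x D]; with [(D - n) (D - p) = 0] this forces the even powers of
    the block matrix to obey a three-term recurrence with coefficients [n + p] and [n p], which is
    the one that defines [T_m]. The explicit term arises because [X X^T] and [X^T X] have different
    sizes, so that their zeroth powers have traces [p] and [n]. *)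

Lemma sum_tupleS (V : nmodType) (S : finType) (N : nat) (F : N.+1.-tuple S -> V) :
  \sum_t F t = \sum_a \sum_(t : N.-tuple S) F [tuple of a :: t].
Proof.
rewrite pair_big /= (reindex (fun u : S * N.-tuple S => [tuple of u.1 :: u.2])) //=.
exists (fun t : N.+1.-tuple S => (thead t, [tuple of behead t])) => [[a t] _|t _] /=.
  by congr pair; apply: val_inj.
by rewrite [RHS]tuple_eta.
Qed.

Section TraceExpansion.
Variable R : comNzRingType.

Fixpoint path_prod (S : Type) (f : S -> S -> R) (a : S) (s : seq S) : R :=
  if s is b :: s' then f a b * path_prod f b s' else 1.

Lemma path_prodE (S : Type) (f : S -> S -> R) (z a : S) (s : seq S) :
  path_prod f a s = \prod_(i < size s) f (nth z (a :: s) i) (nth z (a :: s) i.+1).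
Proof.
elim: s a => [|b s IH] a /=; first by rewrite big_ord0.
by rewrite big_ord_recl /= IH.
Qed.

Lemma mxpow_entry (d N : nat) (A : 'M[R]_d) (i j : 'I_d) :
  (A ^+ N.+1) i j = \sum_(t : N.-tuple 'I_d) path_prod A i (rcons t j).
Proof.
elim: N i j => [|N IH] i j.
  rewrite (big_pred1 [tuple]) /= => [|t]; first by rewrite mulr1 expr1.
  by rewrite [t]tuple0; apply/esym/eqP.
rewrite exprS -mulmxE mxE sum_tupleS; apply: eq_bigr => k _.
by rewrite IH big_distrr.
Qed.

(** The exponent has the form [k.+2] so that positions live in the ring ['I_k.+2], where [s + 1]
    wraps around and closes the walk. *)
Lemma mxtrace_pow_sum (d k : nat) (A : 'M[R]_d) :
  \tr (A ^+ k.+2) =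
  \sum_(x : {ffun 'I_k.+2 -> 'I_d}) \prod_s A (x s) (x (s + 1)).
Proof.
rewrite /mxtrace; under eq_bigr do rewrite mxpow_entry.
rewrite -(@sum_tupleS _ _ _ (fun t => path_prod A (thead t) (rcons (behead t) (thead t)))).
have bijf : bijective (fun t : k.+2.-tuple 'I_d => [ffun i => tnth t i]).
  exists (fun f : {ffun 'I_k.+2 -> 'I_d} => [tuple f i | i < k.+2]) => [t|f].
    by apply: eq_from_tnth => i; rewrite tnth_mktuple ffunE.
  by apply/ffunP => i; rewrite ffunE tnth_mktuple.
rewrite [RHS](reindex _ (onW_bij _ bijf)) /=; apply: eq_bigr => t _.
rewrite (path_prodE _ (thead t)) size_rcons size_behead size_tuple /=.
apply: eq_bigr => s _; rewrite !ffunE.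
have ht : thead t :: behead t = t by rewrite [in RHS](tuple_eta t).
have -> : thead t :: rcons (behead t) (thead t) = rcons t (thead t).
  by rewrite -[in RHS]ht.
congr (A _ _).
  by rewrite nth_rcons size_tuple ltn_ord (tnth_nth (thead t)).
have -> : nth (thead t) (rcons (behead t) (thead t)) s
        = nth (thead t) (rcons t (thead t)) s.+1 by rewrite -[in RHS]ht.
rewrite nth_rcons size_tuple (tnth_nth (thead t)).
have -> : nat_of_ord (s + 1)%R = (s.+1 %% k.+2)%N by rewrite /= modnDmr addn1.
have [lt|ge] := ltnP s.+1 k.+2; first by rewrite modn_small.
have -> : s.+1 = k.+2 by apply/eqP; rewrite eqn_leq ltn_ord ge.
by rewrite eqxx modnn -[in RHS]ht.
Qed.

Lemma mxtrace_expr_mulC (a b N : nat) (A : 'M[R]_(a, b)) (B : 'M[R]_(b, a)) :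
  \tr ((A *m B) ^+ N.+1) = \tr ((B *m A) ^+ N.+1).
Proof.
have H n : (A *m B) ^+ n *m A = A *m (B *m A) ^+ n.
  elim: n => [|n IH]; first by rewrite !expr0 mul1mx mulmx1.
  by rewrite !exprSr -!mulmxE [A *m (_ *m _)]mulmxA -IH !mulmxA.
by rewrite exprSr -mulmxE mulmxA H mxtrace_mulC mulmxA exprS.
Qed.

(** Lets the states of a transfer matrix range over any finite type, such as pairs and disjoint
    sums. *)
Definition kmx (S1 S2 : finType) (f : S1 -> S2 -> R) : 'M[R]_(#|S1|, #|S2|) :=
  \matrix_(i, j) f (enum_val i) (enum_val j).

Lemma kmx_mul (S1 S2 S3 : finType) (f : S1 -> S2 -> R) (g : S2 -> S3 -> R) :
  kmx f *m kmx g = kmx (fun a c => \sum_b f a b * g b c).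
Proof.
apply/matrixP => i j; rewrite !mxE [RHS](reindex (fun k : 'I_#|S2| => enum_val k)) /=; last first.
  exact/onW_bij/enum_val_bij.
by apply: eq_bigr => b _; rewrite !mxE.
Qed.

Lemma eq_kmx (S1 S2 : finType) (f g : S1 -> S2 -> R) : f =2 g -> kmx f = kmx g.
Proof. by move=> fg; apply/matrixP => i j; rewrite !mxE fg. Qed.

Lemma kmx_trace_pow (S : finType) (f : S -> S -> R) k :
  \tr (kmx f ^+ k.+2) = \sum_(x : {ffun 'I_k.+2 -> S}) \prod_s f (x s) (x (s + 1)).
Proof.
rewrite mxtrace_pow_sum.
have bijf : bijective (fun x : {ffun 'I_k.+2 -> 'I_#|S|} =>
    [ffun s => enum_val (x s)] : {ffun 'I_k.+2 -> S}).
  exists (fun x : {ffun 'I_k.+2 -> S} => [ffun s => enum_rank (x s)]) => x;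
    by apply/ffunP => s; rewrite !ffunE ?enum_valK ?enum_rankK.
rewrite [RHS](reindex _ (onW_bij _ bijf)) /=; apply: eq_bigr => x _.
by apply: eq_bigr => s _; rewrite !ffunE mxE.
Qed.

End TraceExpansion.

Section SpikeExpansion.
Variables (R : comNzRingType) (d : nat) (y : 'M[R]_d) (c : 'I_d -> 'I_d -> bool).
Let U := 'I_d.

(* [b v = true] selects the spike around the vertex at position [v], i.e. the two steps
   [v - 1] and [v]; summing over [b] performs the inclusion-exclusion over sets of
   pairwise disjoint spikes. *)
Definition spike_wt (b b' : bool) (u v w : U) : R :=
  match b, b' with
  | false, false => y u v
  | false, true => - ((u == w) && c u v)%:R
  | true, false => 1
  | true, true => 0
  end.

(** The second copy of the vertices stands for the tip of a selected spike: entering it from [v]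
    costs minus the number of admissible tips, and the next step returns to [v] with weight 1. *)
Definition spike_mx : 'M[R]_(d + d) :=
  block_mx y (- diag_mx (\row_u \sum_v (c u v)%:R)) 1%:M 0.

Let S1 := (bool * (U * U))%type.
Let S2 := (U + U * U)%type.
Let S3 := (U + U)%type.

Let La (z z' : S1) : R :=
  (z.2.2 == z'.2.1)%:R * spike_wt z.1 z'.1 z.2.1 z.2.2 z'.2.2.

(* The weight [La] couples three consecutive vertices.  The middle vertex of a selected
   spike is a free summation variable; the factorizations [La = F H], [H F = F' H'] and
   [H' F' = Lk] below sum it out, and traces of powers are unchanged under [A B -> B A]. *)
Let F (z : S1) (t : S2) : R :=
  match z.1, t with
  | false, inl v => (v == z.2.2)%:R * y z.2.1 z.2.2
  | false, inr q => (q == (z.2.2, z.2.1))%:R * - (c z.2.1 z.2.2)%:R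
  | true, inl v => (v == z.2.2)%:R
  | true, inr _ => 0
  end.

Let H (t : S2) (z : S1) : R :=
  match t, z.1 with
  | inl v, false => (v == z.2.1)%:R
  | inr q, true => (q == z.2)%:R
  | _, _ => 0
  end.

Let F' (t : S2) (r : S3) : R :=
  match t, r with
  | inl u, inl v => (v == u)%:R
  | inr q, inr v => (v == q.2)%:R
  | _, _ => 0
  end.

Let H' (r : S3) (t : S2) : R :=
  match r, t with
  | inl u, inl v => y u v
  | inl u, inr q => (u == q.2)%:R * - (c u q.1)%:R
  | inr u, inl v => (u == v)%:R
  | inr _, inr _ => 0
  end.

Let Lk (r r' : S3) : R :=
  match r, r' with
  | inl u, inl v => y u v
  | inl u, inr v => - ((u == v)%:R * \sum_w (c u w)%:R)
  | inr u, inl v => (u == v)%:R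
  | inr _, inr _ => 0
  end.

Lemma sum_delta (S : finType) (a : S) (f : S -> R) : \sum_b (b == a)%:R * f b = f a.
Proof.
rewrite (bigD1 a) //= eqxx mul1r big1 ?addr0 // => b /negPf ->; exact: mul0r.
Qed.

Let FH : kmx La = kmx F *m kmx H.
Proof.
rewrite kmx_mul; apply: eq_kmx => -[b [u v]] [b' [v' w]].
rewrite big_sumType /= /F /H /La /=.
case: b; case: b' => /=.
- by rewrite mulr0 !big1 ?addr0 // => i _; rewrite ?mulr0 ?mul0r.
- rewrite mulr1 [X in _ + X]big1 ?addr0; last by move=> *; rewrite mulr0.
  by rewrite sum_delta.
- rewrite big1 ?add0r; last by move=> *; rewrite mulr0.
  under eq_bigr do rewrite -mulrA; rewrite sum_delta xpair_eqE.
  by case: (v == v'); case: (u == w); case: (c u v);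
     rewrite /= ?mulr0n ?mulr1n ?mul0r ?mulr0 ?oppr0 ?mul1r ?mulr1 ?mulr0.
- rewrite [X in _ + X]big1 ?addr0; last by move=> *; rewrite mulr0.
  by under eq_bigr do rewrite -mulrA; rewrite sum_delta mulrC.
Qed.

Let HF : kmx H *m kmx F = kmx F' *m kmx H'.
Proof.
rewrite !kmx_mul; apply: eq_kmx => -[v|[v u]] t.
- rewrite [RHS]big_sumType /= /F' /=.
  rewrite [X in _ = _ + X]big1 ?addr0; last by move=> *; rewrite mul0r.
  rewrite sum_delta /H /F /=.
  rewrite -(pair_bigA _ (fun b q => match b with true => 0 | false => (v == q.1)%:R end
     * match b, t with
       | true, inl w => (w == q.2)%:R | false, inl w => (w == q.2)%:R * y q.1 q.2
       | true, inr _ => 0 | false, inr r => (r == (q.2, q.1))%:R * - (c q.1 q.2)%:R end)) /=.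
  rewrite big_bool /= big1 ?add0r; last by move=> *; rewrite mul0r.
  rewrite -(pair_bigA _ (fun a b => (v == a)%:R *
     match t with inl w => (w == b)%:R * y a b
       | inr r => (r == (b, a))%:R * - (c a b)%:R end)) /=.
  under eq_bigr do rewrite -big_distrr /= eq_sym; rewrite sum_delta.
  case: t => [w|[a b]] /=.
    by under eq_bigr do rewrite eq_sym; rewrite sum_delta.
  under eq_bigr do rewrite xpair_eqE -mulnb natrM eq_sym -mulrA.
  by rewrite sum_delta eq_sym.
- rewrite [RHS]big_sumType /= /F' /=.
  rewrite [X in _ = X + _]big1 ?add0r; last by move=> *; rewrite mul0r.
  rewrite sum_delta /H /F /=.
  rewrite (bigD1 (true, (v, u))) //= eqxx mul1r big1 ?addr0.
    by case: t => [w|//]; rewrite eq_sym.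
  move=> [[] q] /=; last by rewrite mul0r.
  rewrite xpair_eqE eqxx /= => /negPf; rewrite eq_sym => ->.
  by rewrite mul0r.
Qed.

Let HF' : kmx H' *m kmx F' = kmx Lk.
Proof.
rewrite kmx_mul; apply: eq_kmx => r r'; rewrite big_sumType /= /H' /F' /Lk.
case: r => u; case: r' => v /=.
- rewrite [X in _ + X]big1 ?addr0; last by move=> *; rewrite mulr0.
  by under eq_bigr do rewrite mulrC eq_sym; rewrite sum_delta.
- rewrite big1 ?add0r; last by move=> *; rewrite mulr0.
  rewrite -(pair_bigA _ (fun w a => (u == a)%:R * - (c u w)%:R * (v == a)%:R)) /=.
  rewrite big_distrr -sumrN /=; apply: eq_bigr => w _.
  under eq_bigr do rewrite -mulrA eq_sym; rewrite sum_delta.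
  by rewrite eq_sym mulNr mulrC.
- rewrite [X in _ + X]big1 ?addr0; last by move=> *; rewrite mulr0.
  by under eq_bigr do rewrite mulrC eq_sym; rewrite sum_delta eq_sym.
- by rewrite !big1 ?addr0 // => *; rewrite ?mulr0 ?mul0r.
Qed.

Let tr_La k : \tr (kmx La ^+ k.+2) = \tr (spike_mx ^+ k.+2).
Proof.
rewrite FH mxtrace_expr_mulC HF mxtrace_expr_mulC HF' kmx_trace_pow mxtrace_pow_sum.
pose f (r : S3) : 'I_(d + d) := unsplit r.
have bijf : bijective (fun x : {ffun 'I_k.+2 -> S3} =>
    [ffun s => f (x s)] : {ffun 'I_k.+2 -> 'I_(d + d)}).
  exists (fun x : {ffun 'I_k.+2 -> 'I_(d + d)} => [ffun s => fintype.split (x s)]) => x.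
    by apply/ffunP => s; rewrite !ffunE unsplitK.
  by apply/ffunP => s; rewrite !ffunE; exact: fintype.splitK.
rewrite [RHS](reindex _ (onW_bij _ bijf)) /=; apply: eq_bigr => x _.
apply: eq_bigr => s _; rewrite !ffunE /f /spike_mx /Lk.
case: (x s) (x (s + 1)) => u [] v /=; rewrite ?block_mxEul ?block_mxEur ?block_mxEdl ?block_mxEdr //.
- by rewrite !mxE; case: (u == v); rewrite ?mul1r ?mul0r ?oppr0 ?mulr1n ?mulr0n ?oppr0.
- by rewrite mxE.
- by rewrite mxE.
Qed.

Lemma mxtrace_spike k :
  \sum_(x : {ffun 'I_k.+2 -> U}) \sum_(b : {ffun 'I_k.+2 -> bool})
     \prod_s spike_wt (b s) (b (s + 1)) (x s) (x (s + 1)) (x (s + 1 + 1))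
  = \tr (spike_mx ^+ k.+2).
Proof.
rewrite -tr_La kmx_trace_pow.
pose N := k.+2.
pose g (q : {ffun 'I_N -> U} * ({ffun 'I_N -> bool} * {ffun 'I_N -> U})) :
  {ffun 'I_N -> S1} := [ffun s => (q.2.1 s, (q.1 s, q.2.2 s))].
have bijg : bijective g.
  exists (fun z : {ffun 'I_N -> S1} =>
     ([ffun s => (z s).2.1], ([ffun s => (z s).1], [ffun s => (z s).2.2]))).
    by move=> [x [b x']]; congr (_, (_, _)); apply/ffunP => s; rewrite !ffunE.
  by move=> z; apply/ffunP => s; rewrite !ffunE /=; case: (z s) => ? [].
rewrite [RHS](reindex _ (onW_bij _ bijg)) /=.
rewrite -(pair_bigA _ (fun x q => \prod_s La (g (x, q) s) (g (x, q) (s + 1)))) /=.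
apply: eq_bigr => x _.
rewrite -(pair_bigA _ (fun b x' =>
  \prod_s La (g (x, (b, x')) s) (g (x, (b, x')) (s + 1)))) /=.
apply: eq_bigr => b _.
(* The delta in [La] kills every family of second endpoints except the shift of [x]. *)
rewrite (bigD1 [ffun s => x (s + 1)]) //= [X in _ = _ + X]big1 ?addr0.
  by apply: eq_bigr => s _; rewrite !ffunE /La /= ?ffunE eqxx mul1r.
move=> x' nx; have [s sP] : exists s, x' s != x (s + 1).
  apply/existsP; apply: contra_neqT nx; rewrite negb_exists => /forallP h.
  by apply/ffunP => s; rewrite ffunE; apply/eqP; rewrite -[_ == _]negbK h.
by rewrite (bigD1 s) //= !ffunE /La /= (negPf sP) !mul0r.
Qed.

End SpikeExpansion.

(** * Expansion of powers in the polynomials T_m *)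

Section Chebyshev.
Variables (R : comNzRingType) (a b : R).

(* If [t j] is the value of a linear functional at [x^j], then [cheb t m k] is its value at
   [x^k T_m(x)], where [T_0 = 2], [T_1 = x - (a + b)] and
   [T_(m+2) = (x - (a + b)) T_(m+1) - a b T_m]. *)
Fixpoint cheb (t : nat -> R) (m k : nat) : R :=
  match m with
  | 0 => 2 * t k
  | m'.+1 => match m' with
    | 0 => t k.+1 - (a + b) * t k
    | m''.+1 => cheb t m' k.+1 - (a + b) * cheb t m' k - a * b * cheb t m'' k
    end
  end.

Lemma chebSS t m k :
  cheb t m.+2 k = cheb t m.+1 k.+1 - (a + b) * cheb t m.+1 k - a * b * cheb t m k.
Proof. by []. Qed.

(* The coefficient of [h ^ (l - m)] in [(1 + a h)^l (1 + b h)^l]. *)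
Definition ncoef (l m : nat) : R :=
  \sum_(i < l.+1) ('C(l, i) * 'C(l, i + m))%:R * b ^+ i * a ^+ (l - (i + m)).

Let q l m i : R := ('C(l, i) * 'C(l, i + m))%:R * b ^+ i * a ^+ (l - (i + m)).

Let ncoef_wide l m K : (l < K)%N -> ncoef l m = \sum_(i < K) q l m i.
Proof.
move=> lK; rewrite /ncoef -!(big_mkord xpredT (q l m)).
rewrite [RHS](big_cat_nat (leq0n _) lK) /= [X in _ = _ + X]big_nat [X in _ = _ + X]big1 ?addr0 // => i /andP[li _].
by rewrite /q bin_small // mul0n !mul0r.
Qed.

Lemma ncoef_gt l m : (l < m)%N -> ncoef l m = 0.
Proof.
move=> lm; rewrite /ncoef big1 // => i _.
by rewrite [X in (_ * X)%N]bin_small ?muln0 ?mul0r //; lia.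
Qed.

Let aq l m i : ('C(l, i) * 'C(l, i + m))%:R * b ^+ i * a ^+ (l.+1 - (i + m)) = a * q l m i.
Proof.
rewrite /q; have [le|lt] := leqP (i + m) l; first by rewrite subSn // exprS; ring.
by rewrite (bin_small lt) muln0; ring.
Qed.

(** Multiply the generating polynomial by [(1 + a h) (1 + b h) = 1 + (a + b) h + a b h^2] and
    compare coefficients. *)
Lemma ncoefS l m :
  ncoef l.+1 m.+1 = ncoef l m + (a + b) * ncoef l m.+1 + a * b * ncoef l m.+2.
Proof.
rewrite [ncoef l.+1 m.+1]big_ord_recl /=.
rewrite (@ncoef_wide l m l.+2) // (@ncoef_wide l m.+1 l.+1) //
        (@ncoef_wide l m.+2 l.+1) //.
transitivity (\sum_(i < l.+2) q l m i + a * \sum_(i < l.+2) q l m.+1 i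
   + b * \sum_(i < l.+1) q l m.+1 i + a * b * \sum_(i < l.+1) q l m.+2 i); last first.
  by rewrite -(@ncoef_wide l m.+1 l.+2) // (@ncoef_wide l m.+1 l.+1) //; ring.
rewrite [X in _ = X + _ + _ + _]big_ord_recl [X in _ = _ + a * X + _ + _]big_ord_recl /=.
rewrite !mulrDr !big_distrr /= -!addrA.
have -> : forall u v w z r s : R, u + (v + (w + (z + (r + s)))) = (u + w) + (v + z + r + s)
  by move=> *; ring.
rewrite -!big_split /=; congr (_ + _).
  rewrite -aq /q !bin0 !add0n !mul1n !binS natrD; ring.
apply: eq_bigr => i _; rewrite /bump /= !add1n -aq /q.
have -> : (l.+1 - (i.+1 + m.+1) = l - (i + m.+1))%N by lia.
have -> : (l - (i.+1 + m) = l - (i + m.+1))%N by lia.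
have E : ('C(l, i) * 'C(l, i + m.+2))%:R * a ^+ (l - (i + m.+1)) =
         a * (('C(l, i) * 'C(l, i + m.+2))%:R * a ^+ (l - (i + m.+2))) :> R.
  have [le|lt] := leqP (i + m.+2) l.
    by rewrite (_ : (l - (i + m.+1) = (l - (i + m.+2)).+1)%N) ?exprS; [ring|lia].
  by rewrite [X in (_ * X)%N]bin_small // muln0; ring.
have -> : a * b * (('C(l, i) * 'C(l, i + m.+2))%:R * b ^+ i * a ^+ (l - (i + m.+2)))
   = b ^+ i.+1 * (('C(l, i) * 'C(l, i + m.+2))%:R * a ^+ (l - (i + m.+1))).
  by rewrite E exprS; ring.
rewrite !addSn !addnS !binS.
rewrite !natrM !natrD exprS; ring.
Qed.

(** Here the coefficient of [h^(l+1)] enters; by the symmetry [h -> 1 / (a b h)] it is [a b] times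
    that of [h^(l-1)], hence the factor 2. *)
Lemma ncoefS0 l : ncoef l.+1 0 = (a + b) * ncoef l 0 + 2 * (a * b * ncoef l 1).
Proof.
rewrite [ncoef l.+1 0]big_ord_recl /=.
rewrite (@ncoef_wide l 1 l.+1) //.
transitivity (a * \sum_(i < l.+2) q l 0 i
   + b * \sum_(i < l.+1) q l 0 i + 2 * (a * b * \sum_(i < l.+1) q l 1 i)); last first.
  by rewrite -(@ncoef_wide l 0 l.+2) // -(@ncoef_wide l 0 l.+1) //; ring.
rewrite [X in _ = a * X + _ + _]big_ord_recl /=.
rewrite mulrDr !big_distrr /= -!addrA -!big_split /=; congr (_ + _).
  rewrite -aq /q !bin0 !add0n !mul1n; ring.
apply: eq_bigr => i _; rewrite /bump /= !add1n -aq /q.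
rewrite !addn0 !addn1.
have -> : (l.+1 - i.+1 = l - i)%N by lia.
have E : ('C(l, i) * 'C(l, i.+1))%:R * a ^+ (l - i) =
         a * (('C(l, i) * 'C(l, i.+1))%:R * a ^+ (l - i.+1)) :> R.
  have [le|lt] := leqP i.+1 l.
    by rewrite (_ : (l - i = (l - i.+1).+1)%N) ?exprS; [ring|lia].
  by rewrite [X in (_ * X)%N]bin_small // muln0; ring.
have -> : a * b * (('C(l, i) * 'C(l, i.+1))%:R * b ^+ i * a ^+ (l - i.+1))
   = b ^+ i.+1 * (('C(l, i) * 'C(l, i.+1))%:R * a ^+ (l - i)).
  by rewrite E exprS; ring.
rewrite !binS !natrM !natrD exprS; ring.
Qed.

Let ct t m k := if m is 0 then t k else cheb t m k.

(** Induction on [l], from [x T_m = T_(m+1) + (a + b) T_m + a b T_(m-1)]; the recurrence of [ncoef]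
    is the transpose of this one. *)
Let power_ct t l k : t (k + l)%N = \sum_(m < l.+1) ncoef l m * ct t m k.
Proof.
elim: l k => [|l IH] k.
  by rewrite big_ord1 /ncoef big_ord1 /= addn0 bin0 !mul1n; ring.
rewrite addnS -addSn IH.
pose A := \sum_(m < l.+1) ncoef l m * ct t m.+1 k.
pose B := \sum_(m < l.+1) ncoef l m * ct t m k.
pose C := \sum_(m < l.+1) ncoef l m.+1 * ct t m k.
(* The three parts raise, keep and lower [m]. Lowering [T_1] gives [T_0 = 2], whereas [ct] has 1 at
   index 0; the difference is the extra [ncoef l 1 * t k]. *)
transitivity (A + (a + b) * B + a * b * (C + ncoef l 1 * t k)).
  rewrite [LHS]big_ord_recl /A /B [X in _ = X + _ + _]big_ord_recl.
  rewrite [X in _ = _ + (a + b) * X + _]big_ord_recl /C [X in _ = _ + _ + _ * (X + _)]big_ord_recr /=.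
  rewrite (@ncoef_gt l l.+1) // mul0r addr0.
  transitivity (ncoef l 0 * t k.+1 +
    (\sum_(i < l) ncoef l i.+1 * ct t i.+2 k + (a + b) * (\sum_(i < l) ncoef l i.+1 * ct t i.+1 k)
     + a * b * (\sum_(i < l) ncoef l i.+1 * ct t i k + ncoef l 1 * t k))); last first.
    by rewrite /bump /=; ring.
  congr (_ + _); case: (l) => [|l'].
    rewrite !big_ord0 ncoef_gt //; ring.
  rewrite !(@big_ord_recl _ _ _ l') /= !mulrDr.
  have -> : \sum_(i < l') ncoef l'.+1 (bump 0 i).+1 * cheb t (bump 0 i).+1 k.+1 =
     \sum_(i < l') ncoef l'.+1 (bump 0 i).+1 * ct t (bump 0 i).+2 k +
     (a + b) * (\sum_(i < l') ncoef l'.+1 (bump 0 i).+1 * ct t (bump 0 i).+1 k)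
     + a * b * (\sum_(i < l') ncoef l'.+1 (bump 0 i).+1 * ct t (bump 0 i) k).
    rewrite !big_distrr -!big_split /=; apply: eq_bigr => i _; rewrite /bump /=; ring.
  rewrite /=; ring.
rewrite [RHS]big_ord_recl /= ncoefS0.
have -> : \sum_(i < l.+1) ncoef l.+1 (bump 0 i) * cheb t (bump 0 i) k =
  A + (a + b) * (\sum_(i < l.+1) ncoef l i.+1 * ct t i.+1 k)
    + a * b * (\sum_(i < l.+1) ncoef l i.+2 * ct t i.+1 k).
  rewrite /A !big_distrr -!big_split /=; apply: eq_bigr => i _.
  change (ncoef l.+1 i.+1 * ct t i.+1 k = ncoef l i * ct t i.+1 k
    + (a + b) * (ncoef l i.+1 * ct t i.+1 k) + a * b * (ncoef l i.+2 * ct t i.+1 k)).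
  rewrite ncoefS.
  by move: (ct t i.+1 k) => ?; ring.
have -> : B = ncoef l 0 * t k + \sum_(i < l.+1) ncoef l i.+1 * ct t i.+1 k.
  rewrite /B big_ord_recl big_ord_recr /= (@ncoef_gt l l.+1) // mul0r addr0.
  by congr (_ + _); apply: eq_bigr => i _; rewrite /bump.
have -> : C = ncoef l 1 * t k + \sum_(i < l.+1) ncoef l i.+2 * ct t i.+1 k.
  rewrite /C big_ord_recl big_ord_recr /= (@ncoef_gt l l.+2) // mul0r addr0.
  by congr (_ + _); apply: eq_bigr => i _; rewrite /bump.
ring.
Qed.

Lemma power_cheb t l :
  t l = ncoef l 0 * t 0 + \sum_(m < l) ncoef l m.+1 * cheb t m.+1 0.
Proof. by rewrite -[t l]/(t (0 + l)%N) power_ct big_ord_recl. Qed.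

End Chebyshev.

(** * The spike matrix of the complete bipartite graph *)

Definition opp_side (p n : nat) (u v : 'I_(p + n)) : bool := (u < p)%N != (v < p)%N.

Lemma mxscaleAl (R : comNzRingType) (d : nat) (k : R) (A B : 'M[R]_d) :
  k *: (A * B) = k *: A * B.
Proof. by rewrite -!mulmxE scalemxAl. Qed.

Lemma mxscaleAr (R : comNzRingType) (d : nat) (k : R) (A B : 'M[R]_d) :
  k *: (A * B) = A * (k *: B).
Proof. by rewrite -!mulmxE scalemxAr. Qed.

(** [B] is the square of the spike matrix, and the conclusion is the recurrence step of [T_m]. The
    first hypothesis moves [D] across [x] (so [D] commutes with [x * x]), the second reduces
    [D * D]; each block then becomes a formal identity. *)
Lemma block_quartic (R : comNzRingType) (d : nat) (x D : 'M[R]_d) (s q : R) :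
  D * x = s *: x - x * D -> D * D = s *: D - q%:M ->
  let B := block_mx (x * x - D) (- (x * D)) x (- D) in
  B * B = B * block_mx (x * x) 0 0 (x * x) - s *: B - q%:M.
Proof.
move=> DX DD /=.
have DE : D * (x * x) = x * x * D.
  rewrite mulrA DX mulrBl -mxscaleAl -[_ * D * _]mulrA DX mulrBr -mxscaleAr opprB.
  by rewrite addrC addrNK mulrA.
rewrite (@scalar_mx_block _ d d) -!mulmxE.
rewrite !mulmx_block !scale_block_mx !opp_block_mx !add_block_mx.
rewrite !mulmx0 !addr0 !add0r !subr0 !mulmxE.
have EX : x * x * x = x * (x * x) by rewrite mulrA.
move: DE EX; set E := x * x => DE EX.
congr block_mx.
- have -> : - (x * D) * x = E * D - s *: E.
    by rewrite mulNr -mulrA DX mulrBr -mxscaleAr opprB mulrA.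
  rewrite !mulrBr !mulrBl DE DD; move: (E * E) (E * D) (E) (D) => A B C F.
  by apply/matrixP => i j; rewrite !mxE; ring.
- have -> : (E - D) * - (x * D) = - (x * (D * E)) + q *: x.
    rewrite mulrN mulrBl [E * (_ * _)]mulrA EX -[x * E * D]mulrA DE [D * (_ * _)]mulrA DX mulrBl.
    rewrite -mxscaleAl -[x * D * D]mulrA DD mulrBr -mxscaleAr -!mulmxE mul_mx_scalar; move: (x *m (E *m D)) => A.
    move: (x *m D) (x) => B C.
    by apply/matrixP => i j; rewrite !mxE; ring.
  rewrite mulrNN -mulrA DD mulrBr -mxscaleAr -!mulmxE mul_mx_scalar !mulmxE mulNr mulrA.
  move: (x * D * E) (x * D) (x) => A B C.
  by apply/matrixP => i j; rewrite !mxE; ring.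
- rewrite mulrBr mulNr DX; move: (x * E) (x * D) (x) => A B C.
  by apply/matrixP => i j; rewrite !mxE; ring.
- rewrite mulrN mulrNN mulrA DD mulNr DE; move: (E * D) (D) => A B.
  by apply/matrixP => i j; rewrite !mxE; ring.
Qed.

Section BipartiteTrace.
Variables (R : comNzRingType) (p n : nat) (X : 'M[R]_(p, n)).
Let a : R := n%:R.
Let b : R := p%:R.

Definition bip_mx : 'M[R]_(p + n) := block_mx 0 X X^T 0.

Definition tr_gram (k : nat) : R := \tr ((X *m X^T) ^+ k).

Let D : 'M[R]_(p + n) := block_mx a%:M 0 0 b%:M.
Let D' : 'M[R]_(p + n) := block_mx b%:M 0 0 a%:M.
Let E : 'M[R]_(p + n) := bip_mx * bip_mx.
Let W := X *m X^T.
Let W' := X^T *m X.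

Lemma opp_side_degree :
  diag_mx (\row_u \sum_(v : 'I_(p + n)) (opp_side u v)%:R) = D.
Proof.
apply/matrixP => u v; rewrite !mxE.
case: (splitP u) => i ui; rewrite !mxE; case: (splitP v) => j vj; rewrite ?mxE.
- have -> : (u == v) = (i == j) by rewrite -!val_eqE /= ui vj.
    congr (_ *+ _); rewrite big_split_ord /= big1 ?add0r.
    rewrite (eq_bigr (fun=> 1)) ?sumr_const ?card_ord // => k _.
    by rewrite /opp_side /= ui ltn_ord ltnNge leq_addr.
  by move=> k _; rewrite /opp_side /= ui !ltn_ord.
- by rewrite (_ : u == v = false) // -val_eqE /= ui vj; apply/eqP; have := ltn_ord i; lia.
- by rewrite (_ : u == v = false) // -val_eqE /= ui vj; apply/eqP; have := ltn_ord j; lia.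
- have -> : (u == v) = (i == j) by rewrite -!val_eqE /= ui vj eqn_add2l.
  congr (_ *+ _); rewrite big_split_ord /= addrC big1 ?add0r.
    rewrite (eq_bigr (fun=> 1)) ?sumr_const ?card_ord // => k _.
    by rewrite /opp_side /= ui ltn_ord ltnNge leq_addr.
  by move=> k _; rewrite /opp_side /= ui ![(p + _ < p)%N]ltnNge !leq_addr.
Qed.

Let XD : bip_mx * D = D' * bip_mx.
Proof.
rewrite -!mulmxE !mulmx_block !mul0mx !mulmx0 !addr0 !add0r.
by rewrite !mul_scalar_mx !mul_mx_scalar.
Qed.

Let DD' : D' = (a + b)%:M - D.
Proof.
rewrite (@scalar_mx_block _ p n) /D /D' opp_block_mx add_block_mx !subr0 -!raddfB /=.
by rewrite addrK addrAC addrN add0r.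
Qed.

Let DD : D * D = (a + b) *: D - (a * b)%:M.
Proof.
rewrite (@scalar_mx_block _ p n) /D -mulmxE mulmx_block !mul0mx !mulmx0 !addr0 !add0r.
rewrite scale_block_mx opp_block_mx add_block_mx !scaler0 !subr0 -!scalar_mxM.
by rewrite !scale_scalar_mx -!raddfB /=; congr block_mx; congr (_%:M); ring.
Qed.

Let DX : D * bip_mx = (a + b) *: bip_mx - bip_mx * D.
Proof. by rewrite XD DD' mulrBl -mulmxE mul_scalar_mx opprB addrCA addrN addr0. Qed.

Let L := spike_mx bip_mx (@opp_side p n).
Let EE : 'M[R]_((p + n) + (p + n)) := block_mx E 0 0 E.

Let LE : L = block_mx bip_mx (- D) 1%:M 0.
Proof. by rewrite /L /spike_mx opp_side_degree. Qed.

Let L2 : L ^+ 2 = block_mx (E - D) (- (bip_mx * D)) bip_mx (- D).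
Proof.
rewrite expr2 LE -mulmxE mulmx_block !mulmx0 !mul0mx !addr0 !mul1mx !mulmx1.
by rewrite mulmxN mulmxE.
Qed.

Let L4 : L ^+ 4 = L ^+ 2 * EE - (a + b) *: L ^+ 2 - (a * b)%:M.
Proof.
by rewrite (_ : 4 = 2 + 2)%N // exprD L2; apply: block_quartic DX DD.
Qed.

Let Epow k : E ^+ k = block_mx (W ^+ k) 0 0 (W' ^+ k).
Proof.
elim: k => [|k IH]; first by rewrite !expr0 -scalar_mx_block.
rewrite exprS IH /E -!mulmxE !mulmx_block !mul0mx !mulmx0 !addr0 !add0r.
by rewrite !exprS -!mulmxE ?mulmx_block ?mul0mx ?mulmx0 ?addr0 ?add0r.
Qed.

Let EEpow k : EE ^+ k = block_mx (E ^+ k) 0 0 (E ^+ k).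
Proof.
elim: k => [|k IH]; first by rewrite !expr0 -scalar_mx_block.
by rewrite exprS IH -!mulmxE !mulmx_block !mul0mx !mulmx0 !addr0 !add0r exprS.
Qed.

(** The exponent 0, where the sizes [n] and [p] show, is the only discrepancy; the explicit term of
    [uE] grows from it. *)
Let tr_gram' k : \tr (W' ^+ k) = tr_gram k + (k == 0%N)%:R * (a - b).
Proof.
case: k => [|k].
  by rewrite /tr_gram !expr0 !mxtrace1 mul1r addrCA addrN addr0.
by rewrite mul0r addr0 /tr_gram mxtrace_expr_mulC.
Qed.

Let u m k := \tr (L ^+ (2 * m) * EE ^+ k).

Let uSS m k : u m.+2 k = u m.+1 k.+1 - (a + b) * u m.+1 k - a * b * u m k.
Proof.
rewrite /u (_ : 2 * m.+2 = 2 * m + 4)%N; last by lia.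
rewrite (_ : 2 * m.+1 = 2 * m + 2)%N; last by lia.
rewrite (exprD L (2 * m) 4) (exprD L (2 * m) 2) L4 [EE ^+ k.+1]exprS.
move: (L ^+ (2 * m)) (L ^+ 2) => A B.
rewrite !mulrBr !mulrBl !raddfB /= !mulrA -mxscaleAr -mxscaleAl mxtraceZ; congr (_ - _ - _).
by rewrite -!mulmxE mul_mx_scalar -scalemxAl mxtraceZ.
Qed.

(** At [k = 0] the discrepancy obeys the recurrence with [x] replaced by 0, whose characteristic
    roots are [- a] and [- b]; the values at [m = 0, 1] select [(- b) ^+ m]. The outer factor 2
    counts the two vertex copies. *)
Let uE m k : u m k = 2 * cheb a b tr_gram m k + 2 * ((k == 0%N)%:R * (a - b) * (- b) ^+ m).
Proof.
suff : (forall k, u m k = 2 * cheb a b tr_gram m k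
           + 2 * ((k == 0%N)%:R * (a - b) * (- b) ^+ m)) /\
       (forall k, u m.+1 k = 2 * cheb a b tr_gram m.+1 k
           + 2 * ((k == 0%N)%:R * (a - b) * (- b) ^+ m.+1)) by case.
elim: m {k} => [|m [IH1 IH2]]; split => // k.
- rewrite /u muln0 expr0 mul1r EEpow mxtrace_block Epow mxtrace_block tr_gram' -/(tr_gram k) /=.
  by rewrite /tr_gram; ring.
- rewrite /u muln1 L2 EEpow -mulmxE mulmx_block !mulmx0 !addr0 !add0r mxtrace_block.
  rewrite mulmxBl mulNmx !raddfB raddfN /= mulmxE -exprS !Epow -mulmxE mulmx_block.
  rewrite !mul0mx !mulmx0 !addr0 !add0r !mul_scalar_mx !mxtrace_block !mxtraceZ !tr_gram'.
  rewrite -/(tr_gram k) -/(tr_gram k.+1) /= /tr_gram; case: (k == 0%N); ring.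
- rewrite uSS IH1 !IH2 chebSS /=; case: (k == 0%N); rewrite ?mulr0n ?mulr1n !exprS; ring.
Qed.

Lemma mxtrace_spike_bip m :
  \tr (spike_mx bip_mx (@opp_side p n) ^+ (2 * m)) =
  2 * (cheb n%:R p%:R tr_gram m 0 + (n%:R - p%:R) * (- p%:R) ^+ m).
Proof.
by have := uE m 0; rewrite /u expr0 mulr1 -/L => ->; rewrite eqxx mul1r mulrDr.
Qed.

Lemma tr_gram_bip k : 2 * tr_gram k.+1 = \tr (bip_mx ^+ (2 * k.+1)).
Proof.
rewrite exprM expr2 -/E Epow mxtrace_block tr_gram' /= mul0r addr0 -/(tr_gram k.+1).
by rewrite mulr_natl mulr2n.
Qed.

End BipartiteTrace.

(** * Closed walks on the complete bipartite graph *)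

Section Walks.
Variables (p n : nat).
Local Notation U := 'I_(p + n).

(** The unoriented edge is the index pair of a matrix entry, kept in [nat * nat] so that it
    addresses the variables independently of [p] and [n]. *)
Definition edge_of (u v : U) : nat * nat :=
  if (u < p)%N then (u : nat, (v - p)%N) else (v : nat, (u - p)%N).

Lemma opp_sideC (u v : U) : opp_side u v = opp_side v u.
Proof. by rewrite /opp_side eq_sym. Qed.

Lemma edge_ofC (u v : U) : opp_side u v -> edge_of u v = edge_of v u.
Proof. by rewrite /opp_side /edge_of; case: (ltnP u p); case: (ltnP v p) => //=. Qed.

Lemma edge_of_inj (u v u' v' : U) : opp_side u v -> opp_side u' v' ->
  edge_of u v = edge_of u' v' -> (u = u' /\ v = v') \/ (u = v' /\ v = u').
Proof.
rewrite /opp_side /edge_of.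
case: (ltnP u p); case: (ltnP v p); case: (ltnP u' p); case: (ltnP v' p) => //=.
- by move=> h1 h2 h3 h4 _ _ [e1 e2]; left; split; apply: val_inj => //=; lia.
- by move=> h1 h2 h3 h4 _ _ [e1 e2]; right; split; apply: val_inj => //=; lia.
- by move=> h1 h2 h3 h4 _ _ [e1 e2]; right; split; apply: val_inj => //=; lia.
- by move=> h1 h2 h3 h4 _ _ [e1 e2]; left; split; apply: val_inj => //=; lia.
Qed.

Variable k : nat.
Local Notation N := k.+2.
Implicit Types (x : {ffun 'I_N -> U}) (b : {ffun 'I_N -> bool}).

Definition alternating x := [forall s, opp_side (x s) (x (s + 1))].

Definition step_edge x s := edge_of (x s) (x (s + 1)).

Lemma step_edge_eq x s t : alternating x -> step_edge x s = step_edge x t ->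
  (x s = x t /\ x (s + 1) = x (t + 1)) \/ (x s = x (t + 1) /\ x (s + 1) = x t).
Proof. by move=> /forallP ax; apply: edge_of_inj. Qed.

Lemma step_edge_spike x s : alternating x -> x (s - 1) = x (s + 1) ->
  step_edge x (s - 1) = step_edge x s.
Proof.
move=> /forallP ax e; rewrite /step_edge subrK e edge_ofC //.
by rewrite opp_sideC.
Qed.

Lemma side_nat x i : alternating x ->
  (x i%:R%R < p)%N = (x 0%R < p)%N (+) odd i.
Proof.
move=> /forallP ax; elim: i => [|i IH]; first by rewrite addbF.
have := ax i%:R; rewrite /opp_side IH -natr1 /=.
by case: (x 0%R < p)%N; case: (odd i); case: (x _ < p)%N.
Qed.

(* No edge is used only once, and no spike ([x (s - 1) = x (s + 1)]) sits on an edge that is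
   used only by the two steps [s - 1] and [s] of that spike. *)
Definition reduced_walk x := alternating x /\
  (forall s, exists2 t, t != s & step_edge x t = step_edge x s) /\
  (forall s, x (s - 1) = x (s + 1) ->
     exists t, [/\ t != s, t != s - 1 & step_edge x t = step_edge x s]).

(** Another use of the edge of step [s] revisits [x s] at its start or at its end. The end is [s]
    itself only if the two uses form a spike around [s]; then a third use of the edge helps. *)
Lemma reduced_walk_revisit x s : reduced_walk x -> exists2 t, t != s & x t = x s.
Proof.
move=> [ax [dbl spk]]; have [t ts] := dbl s.
case/(step_edge_eq ax) => [[e _]|[sp e]]; first by exists t.
have [t1s|t1s] := eqVneq (t + 1) s; last by exists (t + 1).
have et : t = s - 1 by rewrite -t1s addrK.
rewrite et in sp.
have [r [rs rs1]] := spk s sp.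
case/(step_edge_eq ax) => [[e' _]|[_ e']]; first by exists r.
exists (r + 1) => //; apply: contra_neq rs1 => <-; by rewrite addrK.
Qed.

(** Pigeonhole: [2 m] positions share at least [m] vertices, each visited twice or more, so a third
    visit would exceed the total. The map [o] sends a position to the other visit of its vertex. *)
Lemma walk_other_visit x m : (2 <= m)%N -> N = (2 * m)%N ->
  (forall s, exists2 t, t != s & x t = x s) -> (m <= #|[set x s | s : 'I_N]|)%N ->
  exists o : 'I_N -> 'I_N, forall s,
    [/\ o s != s, x (o s) = x s & forall t, x t = x s -> t = s \/ t = o s].
Proof.
move=> m2 Nm rev mV.
have H s : exists t, [/\ t != s, x t = x s & forall r, x r = x s -> r = s \/ r = t].
  have [t ts xt] := rev s; exists t; split=> // r xr.
  have [->|rs] := eqVneq r s; first by left.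
  have [->|rt] := eqVneq r t; first by right.
  exfalso; set Im := [set x s | s : 'I_N] in mV.
  pose c u := #|[set s | x s == u]|.
  have c2 u : u \in Im -> (2 <= c u)%N.
    move=> /imsetP[i _ ->]; have [j ji xj] := rev i.
    rewrite /c (cardsD1 i) inE eqxx (cardsD1 j) !inE ji xj eqxx //.
  have sc : (\sum_(u in Im) c u = N)%N.
    rewrite -[RHS](card_ord N) -sum1_card (partition_big (fun i => x i) (mem Im)) /=.
      by apply: eq_bigr => u _; rewrite /c -sum1_card; apply: eq_bigl => i; rewrite inE.
    by move=> i _; apply: imset_f.
  have xs : x s \in Im by apply: imset_f.
  have c3 : (3 <= c (x s))%N.
    rewrite /c (cardsD1 s) inE eqxx (cardsD1 t) !inE ts xt eqxx (cardsD1 r) !inE rt rs xr eqxx //.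
  have : (\sum_(u in Im) 2 < \sum_(u in Im) c u)%N.
    rewrite (bigD1 (x s)) //= [X in (_ < X)%N](bigD1 (x s)) //= -addSn.
    by apply: leq_add => //; apply: leq_sum => u /andP[/c2].
  by rewrite sc sum_nat_const Nm; lia.
exists (fun s => xget s [set t | [/\ t != s, x t = x s & forall r, x r = x s -> r = s \/ r = t]]%classic).
by move=> s; case: xgetP => [t -> //|]; have [t ht] := H s => /(_ t).
Qed.

Lemma ord_natr_val (i : 'I_N) : (nat_of_ord i)%:R = i :> 'I_N.
Proof. by apply: val_inj; rewrite Zp_nat /= modn_small. Qed.

Lemma ord_natr_eq0 (i : nat) : ((i%:R : 'I_N) == 0) = (i %% N == 0)%N.
Proof. by rewrite Zp_nat -val_eqE /=. Qed.

Section TwoVisits.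
Variables (x : {ffun 'I_N -> U}) (m : nat) (o : 'I_N -> 'I_N).
Hypotheses (m2 : (2 <= m)%N) (Nm : N = (2 * m)%N) (rx : reduced_walk x).
Hypothesis oP : forall s,
  [/\ o s != s, x (o s) = x s & forall t, x t = x s -> t = s \/ t = o s].

Let ax : alternating x. Proof. by case: rx. Qed.
Let two0 : (1 + 1 : 'I_N) != 0.
Proof. by rewrite -[1 + 1]/(2%:R) ord_natr_eq0 modn_small //; lia. Qed.
Let oK s : o (o s) = s.
Proof.
have [h1 h2 _] := oP s; have [h3 h4 h5] := oP (o s).
by case: (h5 s) => // e; rewrite -e eqxx in h1.
Qed.

Let oE s t : x t = x s -> t != s -> t = o s.
Proof. by move=> e ne; case: (oP s) => _ _ /(_ t e)[] // ee; rewrite ee eqxx in ne. Qed.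

Let xo s : x (o s) = x s. Proof. by case: (oP s). Qed.
Let on s : o s != s. Proof. by case: (oP s). Qed.

Let o_even s : ~~ odd `|nat_of_ord (o s) - nat_of_ord s|%N.
Proof.
have := side_nat (o s) ax; have := side_nat s ax.
rewrite !ord_natr_val xo => ->.
by move: (x 0%R < p)%N (nat_of_ord (o s)) (nat_of_ord s) => []; lia.
Qed.

Let neqd (t u d : 'I_N) : t - u = d -> d != 0 -> t != u.
Proof. by move=> <-; rewrite subr_eq0. Qed.

(** A third use of the spike's edge extends the backtracking on one side, and the repeated edge on
    the other side extends it there as well. Then [s - 1] and [s + 3] are both the second visit of
    [x (s + 1)], so they coincide. *)
Let spike4 s : o s = s + 1 + 1 -> (4%:R : 'I_N) = 0.
Proof.
move=> os; have [_ [dbl spk]] := rx.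
have vs t : x t = x s -> t = s \/ t = s + 1 + 1.
  by case: (oP s) => _ _ h /h; rewrite os.
have xs2 : x (s + 1 + 1) = x s by rewrite -os xo.
have key : x (s - 1) = x (s + 1) -> x (s + 1 + 1 + 1) = x (s + 1) -> (4%:R : 'I_N) = 0.
  move=> /oE e1 /oE e2.
  have e : s - 1 = s + 1 + 1 + 1.
    rewrite e1; last by rewrite eq_sym; apply: (neqd _ two0); ring.
    by rewrite e2 //; apply: (neqd _ two0); ring.
  have -> : (4%:R : 'I_N) = (s + 1 + 1 + 1) - (s - 1) by ring.
  by rewrite e subrr.
have s1 : x (s + 1 - 1) = x (s + 1 + 1) by rewrite addrK xs2.
have [t [ts1 ts]] := spk (s + 1) s1; rewrite addrK in ts.
case/(step_edge_eq ax) => [[xt xt1]|[xt xt1]].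
- rewrite xs2 in xt1; have xm : x (s - 1) = x (s + 1).
    case: (vs _ xt1) => [e|/addIr e]; last by rewrite e eqxx in ts1.
    by rewrite -xt -e addrK.
  apply: (key xm); have [r rs] := dbl (s + 1 + 1).
  case/(step_edge_eq ax) => [[xr <-]|[<- xr1]].
    rewrite xs2 in xr; case: (vs _ xr) => [-> //|e].
    by rewrite e eqxx in rs.
  rewrite xs2 in xr1; case: (vs _ xr1) => [e|/addIr -> //].
  by rewrite -xm -e addrK.
- rewrite xs2 in xt; have xm : x (s + 1 + 1 + 1) = x (s + 1).
    case: (vs _ xt) => [e|e]; first by rewrite e eqxx in ts.
    by rewrite -xt1 e.
  apply: key (xm); have [r rs] := dbl (s - 1).
  case/(step_edge_eq ax); rewrite subrK => -[].
    move=> <- /vs[e|/addIr -> //].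
    by rewrite -e addrK eqxx in rs.
  by move=> /vs[] -> <-.
Qed.

(** The edge of step [s] is run through again, in the same or in the opposite direction; excluding
    spikes makes the ends of that second run the partners of [s] and [s + 1]. *)
Let nospike_case s : (forall t, o t != t + 1 + 1) ->
  o (s + 1) = o s + 1 \/ o (s + 1) = o s - 1.
Proof.
move=> ns; have [_ [dbl _]] := rx; have [r rs] := dbl s.
case/(step_edge_eq ax) => [[xr xr1]|[xr xr1]].
  left; rewrite -(oE xr rs); apply/esym/oE => //.
  by apply: contra_neq rs => /addIr.
have [e|nr] := eqVneq r (s + 1).
  have : r + 1 = o s by apply: oE => //; rewrite e; apply: (neqd _ two0); ring.
  by rewrite e => h; have := ns s; rewrite h eqxx.
have er : r = o (s + 1) by apply: oE.
right; rewrite -er; have [e|nr1] := eqVneq (r + 1) s.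
  have := ns r; rewrite er oK -er -e.
  by rewrite eqxx.
by rewrite -(oE xr1 nr1) addrK.
Qed.

Lemma two_visits_periodic : ~~ odd m /\ forall s, x (s + m%:R) = x s.
Proof.
have side0 i : x i%:R = x 0 -> ~~ odd i.
  by move=> e; have := side_nat i ax; rewrite e; case: (_ < _)%N; case: odd.
have [/existsP[s /eqP os]|] := boolP [exists t, o t == t + 1 + 1].
  have /eqP := spike4 os; rewrite ord_natr_eq0 => N4.
  have m2' : m = 2%N by move: N4; rewrite Nm => /eqP; case: m m2 => [|[|[|m']]] // _; rewrite modn_small //; lia.
  split; first by rewrite m2'.
  (* Among four positions, a partner at an even nonzero distance is two steps away. *)
  move=> t; rewrite m2' -[RHS]xo; congr (x _); apply: val_inj; rewrite Zp_nat /=.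
  have k2 : k = 2%N by lia.
  have := o_even t; have := on t; rewrite -val_eqE /=.
  have := ltn_ord (o t); have := ltn_ord t.
  by move: (nat_of_ord (o t)) (nat_of_ord t) => c e; rewrite k2; lia.
rewrite negb_exists => /forallP ns.
have [oS1|oP1] := nospike_case 0 ns.
(* The direction cannot change, since [i] and [i + 2] would get the same partner. So [o] is a
   translation; being an involution without fixed points, it is the translation by [m]. *)
- have oA (i : nat) : o i%:R = o 0 + i%:R /\ o (i%:R + 1) = o i%:R + 1.
    elim: i => [|i [IH1 IH2]]; first by rewrite addr0.
    split; first by rewrite -natr1 IH2 IH1 addrA.
    rewrite -natr1; case: (nospike_case (i%:R + 1) ns) => // e.
    move: e; rewrite IH2 addrK => /(congr1 o); rewrite !oK => /eqP.
    by rewrite (negPf (neqd _ two0)) //; ring.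
  have oS s : o s = o 0 + s by rewrite -[s]ord_natr_val; case: (oA s).
  have c2 : o 0 + o 0 = 0 by rewrite -oS oK.
  have cm : o 0 = m%:R.
    apply: val_inj; rewrite Zp_nat /= modn_small; last by lia.
    have := on 0; rewrite -val_eqE /=; move/(congr1 val): c2 => /=.
    have := ltn_ord (o 0); move: (nat_of_ord (o 0)) => c; rewrite Nm => cl h c0.
    have := divn_eq (c + c) (2 * m); rewrite h addn0.
    have : ((c + c) %/ (2 * m) < 2)%N by rewrite ltn_divLR; lia.
    by case: (_ %/ _)%N => [|[|q]] //; lia.
  split; first by apply: side0; rewrite -cm xo.
  by move=> s; rewrite addrC -cm -oS xo.
(* Here [o] would be the reflection [s -> o 0 - s]; as [o 0] is even, its half would be a fixed
   point. *)
- exfalso; have oB (i : nat) : o i%:R = o 0 - i%:R /\ o (i%:R + 1) = o i%:R - 1.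
    elim: i => [|i [IH1 IH2]]; first by rewrite subr0.
    split; first by rewrite -natr1 IH2 IH1 opprD addrA.
    rewrite -natr1; case: (nospike_case (i%:R + 1) ns) => // e.
    move: e; rewrite IH2 subrK => /(congr1 o); rewrite !oK => /eqP.
    by rewrite (negPf (neqd _ two0)) //; ring.
  have ev : ~~ odd (o 0) by apply: side0; rewrite ord_natr_val xo.
  have [+ _] := oB (o 0)./2; apply/eqP.
  rewrite -[X in X - _](ord_natr_val (o 0)) -{2}(even_halfK ev) -addnn natrD addrK.
  exact: on.
Qed.

End TwoVisits.

Lemma reduced_walk_periodic x m : (2 <= m)%N -> N = (2 * m)%N -> reduced_walk x ->
  (m <= #|[set x s | s : 'I_N]|)%N -> ~~ odd m /\ forall s, x (s + m%:R) = x s.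
Proof.
move=> m2 Nm rx mV.
have [other oP] := walk_other_visit m2 Nm (fun s => reduced_walk_revisit s rx) mV.
exact: two_visits_periodic m2 Nm rx oP.
Qed.

End Walks.

(** By independence this will be the mean of the product of the entries listed in [es]; an abstract
    sequence [mom] keeps the combinatorics free of probability. *)
Definition moment_prod (R : comNzRingType) (mom : nat -> R) (es : seq (nat * nat)) : R :=
  \prod_(e <- undup es) mom (count_mem e es).

Lemma moment_prodE (R : comNzRingType) (mom : nat -> R) (es S : seq (nat * nat)) :
  mom 0%N = 1 -> uniq S -> {subset es <= S} ->
  moment_prod mom es = \prod_(e <- S) mom (count_mem e es).
Proof.
move=> m0 uS sub; rewrite (bigID (mem es)) /= [X in _ * X]big1 ?mulr1; last first.
  by move=> e /count_memPn ->.
rewrite -big_filter; apply: perm_big; apply: uniq_perm; rewrite ?undup_uniq ?filter_uniq //.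
move=> e; rewrite mem_undup mem_filter; apply/idP/andP => [ee|[]//].
by split=> //; apply: sub.
Qed.

Section WalkWeight.
Variables (R : comNzRingType) (p n k : nat).
Local Notation U := 'I_(p + n).
Local Notation N := k.+2.
Implicit Types (x : {ffun 'I_N -> U}) (b : {ffun 'I_N -> bool}).

Definition spike_coef b x : R :=
  \prod_s (if b s then (~~ b (s + 1))%:R
           else if b (s + 1) then - (x s == x (s + 1 + 1))%:R else 1).

(** Step [s] can be covered by the spike around [s], as its second leg, or by the one around
    [s + 1], as its first. *)
Definition free_step b s := ~~ b s && ~~ b (s + 1).

Definition free_edges b x : seq (nat * nat) :=
  [seq step_edge x s | s <- enum 'I_N & free_step b s].

Definition walk_wt (mom : nat -> R) x : R :=
  \sum_b spike_coef b x * moment_prod mom (free_edges b x).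

Lemma bip_mx_edge (y : nat * nat -> R) (u v : U) :
  bip_mx (\matrix_(i < p, j < n) y (nat_of_ord i, nat_of_ord j)) u v =
  (opp_side u v)%:R * y (edge_of u v).
Proof.
rewrite /bip_mx /opp_side /edge_of !mxE.
case: (splitP u) => i ui; rewrite !mxE; case: (splitP v) => j vj; rewrite ?mxE ui vj.
- by rewrite mul0r.
- by rewrite mul1r addKn.
- by rewrite mul1r addKn.
- by rewrite mul0r.
Qed.

Lemma prod_spike_wt (y : nat * nat -> R) x b :
  \prod_s spike_wt (bip_mx (\matrix_(i < p, j < n) y (nat_of_ord i, nat_of_ord j)))
    (@opp_side p n) (b s) (b (s + 1)) (x s) (x (s + 1)) (x (s + 1 + 1)) =
  (alternating x)%:R * (spike_coef b x * \prod_(e <- free_edges b x) y e).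
Proof.
have [/forallP ax|] := boolP (alternating x).
  rewrite mul1r /spike_coef /free_edges big_map big_filter big_enum_cond /=.
  rewrite [X in _ = _ * X]big_mkcond -big_split /=; apply: eq_bigr => s _.
  rewrite /free_step /spike_wt; case: (b s); case: (b (s + 1)) => /=.
  - by rewrite mul0r.
  - by rewrite mulr1.
  - by rewrite ax andbT mulr1.
  - by rewrite bip_mx_edge ax.
rewrite negb_forall => /existsP[s nop]; rewrite mul0r.
case bs : (b s); last first.
  rewrite (bigD1 s) //= bs; case: (b (s + 1)) => /=.
    by rewrite (negPf nop) andbF oppr0 mul0r.
  by rewrite bip_mx_edge (negPf nop) !mul0r.
(* Step [s] is the second leg of a selected spike; adjacency is tested on the first leg [s - 1],
   which runs along the same edge. *)
rewrite (bigD1 (s - 1)) //= !subrK bs; case: (b (s - 1)) => /=; first by rewrite mul0r.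
case: eqP => [e|]; last by rewrite oppr0 mul0r.
by rewrite e opp_sideC (negPf nop) oppr0 mul0r.
Qed.

Lemma spike_coef_neq0 b x s : spike_coef b x != 0 -> b s ->
  x (s - 1) = x (s + 1) /\ ~~ b (s - 1) /\ ~~ b (s + 1).
Proof.
move=> c0 bs; split; last split.
- apply/eqP; apply: contra_neqT c0 => ne; rewrite /spike_coef (bigD1 (s - 1)) //= subrK bs.
  by case: (b (s - 1)); rewrite ?(negPf ne) ?oppr0 mul0r.
- by apply: contraNN c0 => b1; rewrite /spike_coef (bigD1 (s - 1)) //= subrK bs b1 mul0r.
- by apply: contraNN c0 => b1; rewrite /spike_coef (bigD1 s) //= bs b1 mul0r.
Qed.

Lemma count_free_edges b x e :
  count_mem e (free_edges b x) = #|[pred s | free_step b s && (step_edge x s == e)]|.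
Proof.
rewrite /free_edges count_map count_filter -size_filter cardE enumT /=.
congr size; apply: eq_filter => s /=; by rewrite andbC.
Qed.

Lemma free_step_mem b x s : free_step b s -> step_edge x s \in free_edges b x.
Proof. by move=> fs; apply: map_f; rewrite mem_filter fs mem_enum. Qed.

(** A spike uses its edge twice, so an edge used once is never covered and always contributes the
    factor [mom 1 = 0]. *)
Lemma walk_wt_single (mom : nat -> R) x s : mom 1%N = 0 -> alternating x ->
  (forall t, step_edge x t = step_edge x s -> t = s) -> walk_wt mom x = 0.
Proof.
move=> m1 ax us; rewrite /walk_wt big1 // => b _.
have [->|c0] := eqVneq (spike_coef b x) 0; first by rewrite mul0r.
have one0 : (1 : 'I_N) != 0 by [].
have bs : ~~ b s.
  apply/negP => /(spike_coef_neq0 c0)[e _].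
  have /us := step_edge_spike ax e; move/eqP; rewrite subr_eq addrC -subr_eq subrr.
  by rewrite eq_sym (negPf one0).
have bs1 : ~~ b (s + 1).
  apply/negP => /(spike_coef_neq0 c0)[e _].
  have := step_edge_spike ax e; rewrite addrK => /esym/us/eqP.
  by rewrite -subr_eq0 addrAC subrr add0r (negPf one0).
have fs : free_step b s by rewrite /free_step bs.
rewrite /moment_prod (bigD1_seq (step_edge x s)) ?undup_uniq ?mem_undup ?free_step_mem //=.
rewrite count_free_edges (eq_card (_ : _ =i pred1 s)) ?card1 ?m1 ?mul0r ?mulr0 // => t.
rewrite !inE; apply/andP/eqP => [[_ /eqP /us //]|->]; by rewrite fs eqxx.
Qed.

Lemma free_edges_sub b x : {subset free_edges b x <= undup (map (step_edge x) (enum 'I_N))}.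
Proof.
move=> e /mapP[s]; rewrite mem_filter => /andP[_ _] ->.
by rewrite mem_undup map_f // mem_enum.
Qed.

(** Toggling the selection at [v] reverses the sign: the spike weighs [mom 2 = 1] when unselected
    and [-1] when selected. *)
Lemma walk_wt_double_spike (mom : nat -> R) x v : mom 0%N = 1 -> mom 2%N = 1 ->
  (1 <= k)%N -> alternating x -> x (v - 1) = x (v + 1) ->
  (forall t, step_edge x t = step_edge x v -> t = v \/ t = v - 1) -> walk_wt mom x = 0.
Proof.
move=> m0 m2 k1 ax sp us.
have one0 : (1 : 'I_N) != 0 by [].
have two0 : (1 + 1 : 'I_N) != 0.
  by rewrite -[1 + 1]/(2%:R) ord_natr_eq0 modn_small.
have neqd (t u d : 'I_N) : t - u = d -> d != 0 -> t != u.
  by move=> <-; rewrite subr_eq0.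
pose h b : {ffun 'I_N -> bool} := [ffun s => if s == v then ~~ b s else b s].
have hK : involutive h.
  by move=> b; apply/ffunP => s; rewrite !ffunE; case: eqP => // _; rewrite negbK.
pose F b := spike_coef b x * moment_prod mom (free_edges b x).
suff Fh b : b v -> F (h b) = - F b.
  rewrite /walk_wt (bigID (fun b : {ffun 'I_N -> bool} => b v)) /=.
  rewrite [X in _ + X](reindex_inj (can_inj hK)) /=.
  rewrite [X in _ + X](eq_bigl (fun b : {ffun 'I_N -> bool} => b v)).
    by rewrite -big_split big1 //= => b /Fh; rewrite /F => ->; rewrite addrN.
  by move=> b; rewrite ffunE eqxx negbK.
move=> bv.
have v1 : v - 1 != v by rewrite eq_sym; apply: (neqd _ _ _ _ one0); ring.
have v2 : v + 1 != v by apply: (neqd _ _ _ _ one0); ring.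
(* With a neighbouring spike selected both terms vanish: two selected neighbours are forbidden, and
   a spike around [v - 1] or [v + 1] would be a further use of the edge of [v]. *)
have [b1|b1] := boolP (b (v - 1) || b (v + 1)).
  have Fb : spike_coef b x = 0.
    apply/eqP; apply: contraLR b1 => c0.
    by have [_ [n1 n2]] := spike_coef_neq0 c0 bv; rewrite negb_or n1.
  have Fhb : spike_coef (h b) x = 0.
    apply/eqP; apply: contraLR b1 => c0; rewrite negb_or; apply/andP; split.
      apply/negP => b1; have hb : h b (v - 1) by rewrite ffunE (negPf v1).
      have [e _] := spike_coef_neq0 c0 hb.
      have := step_edge_spike ax e; rewrite (step_edge_spike ax sp) => /us[]; apply/eqP; rewrite eq_sym.
        by apply: (neqd _ _ _ _ two0); ring.
      by apply: (neqd _ _ _ _ one0); ring.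
    apply/negP => b1; have hb : h b (v + 1) by rewrite ffunE (negPf v2).
    have [e _] := spike_coef_neq0 c0 hb.
    have := step_edge_spike ax e; rewrite addrK => /esym/us[]; apply/eqP => //.
    by apply: (neqd _ _ _ _ two0); ring.
  by rewrite /F Fb Fhb !mul0r oppr0.
move: b1; rewrite negb_or => /andP[b1 b2].
rewrite /F -mulNr; congr (_ * _).
  rewrite /spike_coef (bigD1 v) //= (bigD1 (v - 1)) //= [in RHS](bigD1 v) //= [in RHS](bigD1 (v - 1)) //=.
  rewrite !ffunE !subrK !eqxx (negPf v1) (negPf v2) (negPf b1) (negPf b2) bv sp eqxx /=.
  rewrite !mul1r mulN1r opprK; apply: eq_bigr => s /andP[sv sv1].
  rewrite !ffunE (negPf sv) (negPf (_ : s + 1 != v)) //.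
  by apply: contra_neq sv1 => <-; rewrite addrK.
set S := undup (map (step_edge x) (enum 'I_N)).
have uS : uniq S by apply: undup_uniq.
rewrite !(moment_prodE m0 uS); [|exact: free_edges_sub|exact: free_edges_sub].
apply: eq_big_seq => e _; rewrite !count_free_edges.
have [->|ne] := eqVneq e (step_edge x v).
  rewrite (eq_card (_ : _ =i [set v; v - 1])).
    rewrite cards2 eq_sym v1 m2 eq_card0 ?m0 // => t; rewrite !inE /free_step.
    apply/negP => /andP[/andP[n1 n2] /eqP /us[] et].
      by rewrite et bv in n1.
    by rewrite et subrK bv in n2.
  move=> t; rewrite !inE /free_step !ffunE; apply/idP/idP.
    by case/andP=> _ /eqP /us[] ->; rewrite eqxx ?orbT.
  case/orP=> /eqP ->; first by rewrite eqxx bv (negPf v2) b2 eqxx.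
  by rewrite (negPf v1) b1 subrK eqxx bv step_edge_spike // eqxx.
congr mom; apply: eq_card => t; rewrite !inE.
have [/eqP et|_] := boolP (step_edge x t == e); last by rewrite !andbF.
rewrite !andbT /free_step !ffunE (negPf (_ : t != v)); last first.
  by apply: contra_neq ne => <-.
rewrite (negPf (_ : t + 1 != v)) //; apply: contra_neq ne => tv.
by rewrite -(step_edge_spike ax sp) -tv addrK.
Qed.

End WalkWeight.

Section WalkValue.
Variables (R : comNzRingType) (p n k m : nat) (mom : nat -> R).
Hypotheses (Nm : k.+2 = (2 * m)%N) (m0 : mom 0%N = 1) (m2 : mom 2%N = 1).
Local Notation U := 'I_(p + n).
Local Notation N := k.+2.
Variable x : {ffun 'I_N -> U}.
Hypotheses (ax : alternating x) (per : forall s, x (s + m%:R) = x s).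
Hypothesis inj : forall s t, x t = x s -> t = s \/ t = s + m%:R.

Let natr_neq0 i : (0 < i < 2 * m)%N -> (i%:R : 'I_N) != 0.
Proof. by move=> h; rewrite ord_natr_eq0 Nm modn_small; lia. Qed.

Let neqd (t u d : 'I_N) : t - u = d -> d != 0 -> t != u.
Proof. by move=> <-; rewrite subr_eq0. Qed.

Let walk_edge_twice s t : (3 <= m)%N -> step_edge x t = step_edge x s ->
  t = s \/ t = s + m%:R.
Proof.
move=> m3 /(step_edge_eq ax)[[/inj //]|[/inj h1 /inj h2]].
exfalso; case: h1 h2 => -> [] /eqP; apply/negP.
- by apply: (@neqd _ _ 2%:R); [ring|apply: natr_neq0; lia].
- rewrite eq_sym; apply: (@neqd _ _ (m - 2)%:R); last by apply: natr_neq0; lia.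
  by rewrite natrB; [ring|lia].
- apply: (@neqd _ _ (m + 2)%:R); last by apply: natr_neq0; lia.
  by rewrite natrD; ring.
- by apply: (@neqd _ _ 2%:R); [ring|apply: natr_neq0; lia].
Qed.

(** A cycle of length at least 3 has no spike, so only the empty selection counts, and each edge
    contributes [mom 2 = 1]. *)
Lemma walk_wt_periodic : (3 <= m)%N -> walk_wt mom x = 1.
Proof.
move=> m3; rewrite /walk_wt (bigD1 [ffun=> false]) //= [X in _ + X]big1 ?addr0.
  rewrite /spike_coef big1 ?mul1r; last by move=> s _; rewrite !ffunE.
  rewrite /moment_prod big_seq big1 // => e.
  rewrite mem_undup => /mapP[s _ ->]; rewrite count_free_edges.
  rewrite (eq_card (_ : _ =i [set s; s + m%:R])).
    rewrite cards2 eq_sym (@neqd _ _ m%:R) //; first by ring.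
    by apply: natr_neq0; lia.
  move=> t; rewrite !inE /free_step !ffunE /=; apply/eqP/orP.
    by case/(walk_edge_twice m3) => ->; [left|right].
  by case=> /eqP -> //; rewrite /step_edge addrAC !per.
move=> b bn; have [s bs] : exists s, b s.
  apply/existsP; apply: contra_neqT bn; rewrite negb_exists => /forallP h.
  by apply/ffunP => s; rewrite ffunE; apply/negbTE.
have [->|c0] := eqVneq (spike_coef R b x) 0; first by rewrite mul0r.
have [/esym /inj + _] := spike_coef_neq0 c0 bs; case=> /eqP e; exfalso; move: e; apply/negP.
- by apply: (@neqd _ _ 2%:R); [ring|apply: natr_neq0; lia].
- rewrite eq_sym; apply: (@neqd _ _ (m - 2)%:R); last by apply: natr_neq0; lia.
  by rewrite natrB; [ring|lia].
Qed.

End WalkValue.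

Section FourCycle.
Variables (R : comNzRingType).
Let i0 : 'I_4 := @Ordinal 4 0 isT.
Let i1 : 'I_4 := @Ordinal 4 1 isT.
Let i2 : 'I_4 := @Ordinal 4 2 isT.
Let i3 : 'I_4 := @Ordinal 4 3 isT.

Let big4 (V : Type) (idx : V) (op : Monoid.law idx) (F : 'I_4 -> V) :
  \big[op/idx]_s F s = op (F i0) (op (F i1) (op (F i2) (F i3))).
Proof.
rewrite !big_ord_recl big_ord0 Monoid.mulm1.
congr (op (F _) (op (F _) (op (F _) (F _)))); exact: val_inj.
Qed.

Let sum_bool4 (F : bool -> bool -> bool -> bool -> R) :
  \sum_(b : {ffun 'I_4 -> bool}) F (b i0) (b i1) (b i2) (b i3) =
  \sum_a \sum_b \sum_c \sum_d F a b c d.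
Proof.
have bijf : bijective (fun t : 4.-tuple bool => [ffun i => tnth t i]).
  exists (fun f : {ffun 'I_4 -> bool} => [tuple f i | i < 4]) => [t|f].
    by apply: eq_from_tnth => i; rewrite tnth_mktuple ffunE.
  by apply/ffunP => i; rewrite ffunE tnth_mktuple.
rewrite (reindex _ (onW_bij _ bijf)) /=.
do 4![rewrite sum_tupleS; apply: eq_bigr => ? _].
by rewrite (big_pred1 [tuple]) /= => [|t]; [rewrite !ffunE|rewrite [t]tuple0; apply/esym/eqP].
Qed.

(** The empty selection gives [mom 4], each of the four single spikes [- mom 2], and each of the two
    pairs of opposite spikes [+ 1]. *)
Lemma walk_wt_four (p n : nat) (mom : nat -> R) (x : {ffun 'I_4 -> 'I_(p + n)}) :
  mom 0%N = 1 -> mom 2%N = 1 -> alternating x -> (forall s, x (s + 2%:R) = x s) ->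
  walk_wt mom x = mom 4%N - 2.
Proof.
move=> m0 m2 ax per.
have e1 : i0 + 1 = i1 by exact: val_inj.
have e2 : i1 + 1 = i2 by exact: val_inj.
have e3 : i2 + 1 = i3 by exact: val_inj.
have e4 : i3 + 1 = i0 by exact: val_inj.
have ee s : step_edge x s = step_edge x i0.
  have st t : step_edge x (t + 1) = step_edge x t.
    have := @step_edge_spike _ _ _ x (t + 1) ax; rewrite addrK => -> //.
    by rewrite -addrA per.
  have : s = i0 \/ s = i0 + 1 \/ s = i0 + 1 + 1 \/ s = i0 + 1 + 1 + 1.
    rewrite e1 e2 e3; case: s => -[|[|[|[|//]]]] h.
    - by left; apply: val_inj.
    - by right; left; apply: val_inj.
    - by right; right; left; apply: val_inj.
    - by right; right; right; apply: val_inj.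
  by case=> [|[|[|]]] ->; rewrite ?st.
pose fr (a b : bool) := (~~ a && ~~ b) : nat.
pose cf (a b : bool) : R := if a then (~~ b)%:R else if b then - 1 else 1.
pose F a b c d := cf a b * (cf b c * (cf c d * cf d a)) *
  mom (fr a b + (fr b c + (fr c d + fr d a)))%N.
transitivity (\sum_(b : {ffun 'I_4 -> bool}) F (b i0) (b i1) (b i2) (b i3)).
  apply: eq_bigr => b _; congr (_ * _).
    rewrite /spike_coef big4 /= e1 e2 e3 e4 e1.
    have ps s : x s == x (s + 1 + 1) by rewrite -addrA per.
    have := ps i0; have := ps i1; have := ps i2; have := ps i3.
    by rewrite !(e1, e2, e3, e4) => -> -> -> ->.
  rewrite (moment_prodE m0 (_ : uniq [:: step_edge x i0])) //; last first.
    by move=> e /mapP[s _ ->]; rewrite ee inE.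
  rewrite big_seq1 count_free_edges -sum1_card; congr mom.
  rewrite big_mkcond big4 /= !inE /free_step e1 e2 e3 e4 !ee !eqxx !andbT /fr.
  by case: (b i0); case: (b i1); case: (b i2); case: (b i3).
rewrite (sum_bool4 F) !big_bool /= /F /cf /fr /= ?mulr0 ?mul0r ?mulr1 ?mul1r m0 m2.
ring.
Qed.

End FourCycle.

(** * Counting walks *)

Section WalkBound.
Variables (R : realFieldType) (p n k : nat) (mom : nat -> R) (B : R).
Hypotheses (B1 : 1 <= B) (momB : forall j, (j <= k.+2)%N -> `|mom j| <= B).
Local Notation N := k.+2.

Lemma walk_wt_bound (x : {ffun 'I_N -> 'I_(p + n)}) :
  `|walk_wt mom x| <= 2 ^+ N * B ^+ N.
Proof.
have B0 : 0 <= B by apply: le_trans B1.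
rewrite /walk_wt; apply: le_trans (ler_norm_sum _ _ _) _.
apply: (@le_trans _ _ (\sum_(b : {ffun 'I_N -> bool}) B ^+ N)); last first.
  by rewrite sumr_const card_ffun card_bool card_ord -[leLHS]mulr_natl natrX.
apply: ler_sum => b _; rewrite normrM -[B ^+ N]mul1r; apply: ler_pM => //.
  rewrite /spike_coef normr_prod; apply: prodr_ile1 => s; rewrite normr_ge0 /=.
  case: (b s); first by rewrite normr_nat lern1 leq_b1.
  by case: (b (s + 1)); rewrite ?normrN ?normr1 ?normr_nat ?lern1 ?leq_b1.
rewrite /moment_prod normr_prod big_seq.
have sz : (size (undup (free_edges b x)) <= N)%N.
  apply: leq_trans (size_undup _) _; rewrite size_map -[X in (_ <= X)%N](size_enum_ord N).
  by rewrite size_filter; exact: count_size.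
apply: (@le_trans _ _ (\prod_(e <- undup (free_edges b x)) B)).
  rewrite [leRHS]big_seq; apply: ler_prod => e _; rewrite normr_ge0 /=; apply: momB.
  rewrite count_free_edges; apply: leq_trans (max_card _) _; by rewrite card_ord.
by rewrite big_const_seq count_predT iter_mulr_1; apply: ler_weXn2l.
Qed.

End WalkBound.

Section WalkCount.
Variables (p n k m : nat).
Hypotheses (Nm : k.+2 = (2 * m)%N) (m2 : (2 <= m)%N) (p0 : (0 < p)%N) (pn : (p <= n)%N).
Local Notation U := 'I_(p + n).
Local Notation N := k.+2.
Implicit Types (x : {ffun 'I_N -> U}).

Definition side (c : bool) : {set U} := [set u : U | (u < p)%N == c].

Lemma card_side c : #|side c| = if c then p else n.
Proof.
have lr : side true = [set lshift n i | i : 'I_p].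
  apply/setP => u; rewrite inE eqb_id; apply/idP/imsetP => [up|[i _ ->]]; last exact: (ltn_ord i).
  by exists (Ordinal up) => //; apply: val_inj.
have ct : #|side true| = p by rewrite lr card_imset ?card_ord //; exact: lshift_inj.
case: c => //; have -> : side false = ~: side true.
  by apply/setP => u; rewrite !inE; case: (u < p)%N.
by rewrite cardsCs finset.setCK ct card_ord addKn.
Qed.

(** Encodes the partition of the positions by visited vertex; the number of such patterns does not
    depend on [p] and [n]. *)
Let rep x : {ffun 'I_N -> 'I_N} := [ffun s => odflt s [pick t | x t == x s]].

Let repE x s : x (rep x s) = x s.
Proof. by rewrite ffunE; case: pickP => [t /eqP //|]. Qed.

Let rep_eq x s t : x s = x t -> rep x s = rep x t.
Proof.
rewrite !ffunE => e; have : [pick r | x r == x s] = [pick r | x r == x t].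
  by apply: eq_pick => r; rewrite e.
by case: pickP => [r _ <- //|/(_ s)]; rewrite eqxx.
Qed.

Let side_walk x s : alternating x -> x s \in side ((x 0%R < p)%N (+) odd s).
Proof. by move=> ax; rewrite inE; have := side_nat s ax; rewrite ord_natr_val => ->. Qed.

Let small x := alternating x && (#|[set x s | s : 'I_N]| < m)%N.

(** The pattern [r] leaves at most [m - 1] vertices to choose, and [c] fixes the side of each. At
    least one of them is a row, with [p] choices; the others have at most [n]. *)
Lemma card_rep_class (r : {ffun 'I_N -> 'I_N}) (c : bool) :
  (#|[set x | [&& small x, rep x == r & (x 0%R < p)%N == c]]| <= p * n ^ (m - 2))%N.
Proof.
set A := [set x | _].
have [->|[x0 x0A]] := set_0Vmem A; first by rewrite cards0.
have AP x : x \in A -> [/\ alternating x, (#|[set x s | s : 'I_N]| < m)%N, rep x = r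
    & (x 0%R < p)%N = c].
  by rewrite inE => /and3P[/andP[ax sx] /eqP rx /eqP cx]; split.
pose D := [set r s | s : 'I_N].
pose F (s : 'I_N) := side (c (+) odd s).
pose f x : {ffun 'I_N -> U} := [ffun s => if s \in D then x s else x0 0].
have injf : {in A &, injective f}.
  move=> x y /AP[_ _ rx _] /AP[_ _ ry _] /ffunP fxy; apply/ffunP => s.
  have rD : r s \in D by apply: imset_f.
  have := fxy (r s); rewrite !ffunE rD -{1}rx -ry !repE //.
have fA : f @: A \subset pfamily (x0 0) D F.
  apply/fintype.subsetP => _ /imsetP[x /AP[ax _ _ cx] ->]; apply/pfamilyP; split.
    by apply/fintype.subsetP => s; rewrite inE ffunE; case: ifP => // _; rewrite eqxx.
  by move=> s sD; rewrite ffunE sD /F -cx; exact: side_walk.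
rewrite -(card_in_imset injf); apply: leq_trans (subset_leq_card fA) _.
rewrite card_pfamily.
have [ax0 sx0 rx0 cx0] := AP _ x0A.
have Dm : (#|D| <= m - 1)%N.
  have injx : {in D &, injective x0}.
    move=> _ _ /imsetP[s _ ->] /imsetP[t _ ->]; rewrite -{1 2}rx0 !repE => /rep_eq.
    by rewrite rx0.
  rewrite -(card_in_imset injx).
  have : (#|x0 @: D| <= #|[set x0 s | s : 'I_N]|)%N.
    by apply: subset_leq_card; apply/fintype.subsetP => _ /imsetP[s _ ->]; apply: imset_f.
  move=> h; rewrite leq_subRL ?add1n; last by lia.
  exact: leq_ltn_trans h sx0.
(* Position 0 or position 1 is on the row side; its representative supplies the factor [p]. *)
have [s1 s1D ws1] : exists2 s, s \in D & c (+) odd (nat_of_ord s).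
  have [s ws] : exists s : 'I_N, (x0 s < p)%N.
    case c0 : (x0 0%R < p)%N; first by exists 0.
    by exists 1; have := side_nat 1 ax0; rewrite c0 => ->.
  exists (r s); first exact: imset_f.
  by have := side_walk (r s) ax0; rewrite inE cx0 => /eqP <-; rewrite -{1}rx0 repE.
have -> : foldr muln 1%N [seq #|F y| | y in D] = (\prod_(s in D) #|F s|)%N.
  by rewrite /image_mem foldrE big_map big_enum.
rewrite (bigD1 s1) //= [#|F s1|]card_side ws1 leq_mul2l; apply/orP; right.
apply: (@leq_trans (\prod_(s in D | s != s1) n)%N).
  by apply: leq_prod => s _; rewrite [#|_|]card_side; case: ifP.
rewrite prod_nat_const leq_pexp2l //; first by lia.
have -> : #|[pred s in D | s != s1]| = #|D :\ s1|.
  by apply: eq_card => s; rewrite !inE andbC.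
by have := cardsD1 s1 D; rewrite s1D; lia.
Qed.

Lemma card_small_walk :
  (#|[set x | small x]| <= (2 * N ^ N) * (p * n ^ (m - 2)))%N.
Proof.
rewrite -sum1_card.
rewrite (partition_big (fun x => (rep x, (x 0%R < p)%N)) xpredT) //=.
apply: (@leq_trans (\sum_(q : {ffun 'I_N -> 'I_N} * bool) p * n ^ (m - 2))%N).
  apply: leq_sum => -[r c] _; rewrite sum1_card.
  apply: leq_trans (card_rep_class r c); apply: subset_leq_card.
  by apply/fintype.subsetP => x; rewrite !inE => /andP[]; rewrite inE => -> /eqP[-> ->]; rewrite !eqxx.
by rewrite sum_nat_const card_prod card_ffun card_bool !card_ord [(_ * 2)%N]mulnC leqnn.
Qed.

Definition periodic_walks : {set {ffun 'I_N -> U}} :=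
  [set x | alternating x && [forall s, x (s + m%:R) == x s]].

(** Such a walk is an alternating choice at the first [m] positions, half of them on each side; the
    factor 2 is the side of the start. *)
Lemma card_periodic_walks : ~~ odd m -> #|periodic_walks| = (2 * (p * n) ^ m./2)%N.
Proof.
move=> em.
have m0 : (0 < m)%N by exact: ltnW.
pose q (s : 'I_N) : 'I_m := Ordinal (ltn_pmod s m0).
have mN : (m < N)%N by clear -Nm m2; lia.
pose w (i : 'I_m) : 'I_N := Ordinal (ltn_trans (ltn_ord i) mN).
have modN (s : nat) : (s %% N %% m = s %% m)%N by rewrite modn_dvdm // Nm dvdn_mull.
have oddm (s : nat) : odd (s %% m) = odd s.
  by rewrite {2}(divn_eq s m) oddD oddM (negPf em) andbF.
have class c : #|[set x in periodic_walks | (x 0%R < p)%N == c]| = ((p * n) ^ m./2)%N.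
  pose F (i : 'I_m) := side (c (+) odd i).
  pose f (y : {ffun 'I_m -> U}) : {ffun 'I_N -> U} := [ffun s => y (q s)].
  have injf : injective f.
    move=> y z /ffunP fyz; apply/ffunP => i; have := fyz (w i); rewrite !ffunE.
    by rewrite (_ : q (w i) = i) //; apply: val_inj => /=; rewrite modn_small.
  have -> : [set x in periodic_walks | (x 0%R < p)%N == c] = f @: [set y | y \in family F].
    apply/setP => x; apply/idP/imsetP.
      rewrite !inE => /andP[/andP[ax /forallP per] /eqP c0].
      have xmod (s : 'I_N) : x (w (q s)) = x s.
        have [lt|ge] := ltnP s m.
          by congr (x _); apply: val_inj => /=; rewrite modn_small.
        rewrite -(eqP (per _)); congr (x _); apply: val_inj; rewrite Zp_nat /=.
        rewrite (modn_small mN) (_ : s %% m = s - m)%N.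
          by rewrite subnK // modn_small.
        by rewrite -{1}(subnK ge) modnDr modn_small //; have := ltn_ord s; clear -Nm; lia.
      exists [ffun i => x (w i)]; last by apply/ffunP => s; rewrite !ffunE xmod.
      rewrite finset.in_set; apply/familyP => i; rewrite ffunE /F -c0; exact: (side_walk (w i) ax).
    case=> y yf ->; have /familyP yF : y \in family F by rewrite finset.in_set in yf.
    rewrite !inE.
    have sd s : (f y s < p)%N = c (+) odd s.
      by have := yF (q s); rewrite inE ffunE /= oddm => /eqP.
    apply/andP; split; last by rewrite sd addbF.
    apply/andP; split; apply/forallP => s.
      rewrite /opp_side !sd /= modnDmr addn1.
      rewrite (_ : odd (s.+1 %% N) = ~~ odd s); first by case: (c); case: (odd s).
      by rewrite -oddm modN oddm.
    rewrite !ffunE; apply/eqP; congr (y _); apply: val_inj => /=.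
    by rewrite Zp_nat /= modN (modn_small mN) modnDr.
  rewrite card_imset // cardsE card_family /image_mem foldrE big_map big_enum /=.
  rewrite (eq_bigr (fun i : 'I_m => if c (+) odd i then p else n)); last first.
    by move=> i _; rewrite card_side.
  rewrite -[in LHS](even_halfK em); elim: (m./2) => [|h IH]; first by rewrite big_ord0.
  rewrite doubleS !big_ord_recr /= IH odd_double /=.
  by case: (c); rewrite /= expnS -mulnA mulnC // [(n * p)%N]mulnC.
rewrite -sum1_card (bigID (fun x => (x 0%R < p)%N == true)) /= mul2n -addnn.
congr (_ + _)%N; [rewrite -(class true)|rewrite -(class false)];
  by rewrite -sum1_card; apply: eq_bigl => x; rewrite !inE; case: (x 0%R < p)%N.
Qed.

End WalkCount.

Lemma walk_wt_len4 (R : comNzRingType) (p n k : nat) (mom : nat -> R)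
    (x : {ffun 'I_k.+2 -> 'I_(p + n)}) : k = 2%N ->
  mom 0%N = 1 -> mom 2%N = 1 -> alternating x -> (forall s, x (s + 2%:R) = x s) ->
  walk_wt mom x = mom 4%N - 2.
Proof. by move=> k2; move: x; rewrite k2 => x; apply: walk_wt_four. Qed.

Section WalkSum.
Variables (R : realFieldType) (mom : nat -> R) (k m : nat).
Hypotheses (m0 : mom 0%N = 1) (m1 : mom 1%N = 0) (m2 : mom 2%N = 1).
Hypotheses (Nm : k.+2 = (2 * m)%N) (m_ge2 : (2 <= m)%N).
Local Notation N := k.+2.

(** Since [mom 4 - 2 = 1 + (mom 4 - 3)], the degenerate cycle is where the fourth cumulant of the
    theorem comes from. *)
Definition cycle_wt : R := if m == 2%N then mom 4%N - 2 else 1.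

(** A walk with at least [m] vertices that is not periodic cannot be reduced, so it has an edge used
    once or a spike alone on its edge, and either makes the weight zero. *)
Lemma walk_wt_large (p n : nat) (x : {ffun 'I_N -> 'I_(p + n)}) : alternating x ->
  (m <= #|[set x s | s : 'I_N]|)%N ->
  walk_wt mom x = (~~ odd m && (x \in periodic_walks p n k m))%:R * cycle_wt.
Proof.
move=> ax mV; have m0N : (m%:R : 'I_N) != 0 by rewrite ord_natr_eq0 Nm modn_small; lia.
have [/andP[em]|nper] := boolP (~~ odd m && (x \in periodic_walks p n k m)).
  rewrite inE => /andP[_ /forallP per]; rewrite mul1r.
  have per' s : x (s + m%:R) = x s by apply/eqP.
  rewrite /cycle_wt; case: (eqVneq m 2%N) => [m_2|m_ne2]; last first.
    apply: (walk_wt_periodic Nm) => //; last by lia.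
    have rev s : exists2 t, t != s & x t = x s.
      exists (s + m%:R) => //; apply: contra_neq m0N => e.
      by rewrite -[m%:R](addKr s) e addNr.
    have [other oP] := walk_other_visit m_ge2 Nm rev mV.
    move=> s t xt; have [os1 os2 os3] := oP s.
    case: (os3 _ xt) => [|->]; [by left|right].
    case: (os3 (s + m%:R) (per' s)) => // e; exfalso; move: m0N; apply/negP; rewrite negbK.
    by rewrite -[m%:R](addKr s) e addNr.
  have k2 : k = 2%N by lia.
  by apply: walk_wt_len4 => // s; rewrite -m_2.
rewrite mul0r; have nred : ~ reduced_walk x.
  move=> rx; have [em per] := reduced_walk_periodic m_ge2 Nm rx mV.
  by move: nper; rewrite em /= inE ax /= => /forallP; apply => s; apply/eqP.
have [single|nsingle] := pselect (exists s, forall t, step_edge x t = step_edge x s -> t = s).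
  by case: single => s; apply: walk_wt_single.
have [[v [sp us]]|nspike] := pselect (exists v, x (v - 1) = x (v + 1) /\
    forall t, step_edge x t = step_edge x v -> t = v \/ t = v - 1).
  by apply: (walk_wt_double_spike m0 m2 _ ax sp us); lia.
exfalso; apply: nred; split=> //; split=> [s|s sp].
  apply: contrapT => h; apply: nsingle; exists s => t e.
  by apply/eqP; apply: contrapT => /negP ts; apply: h; exists t.
apply: contrapT => h; apply: nspike; exists s; split=> // t e.
have [->|ts] := eqVneq t s; first by left.
have [->|ts1] := eqVneq t (s - 1); first by right.
by exfalso; apply: h; exists t.
Qed.

Lemma walk_sum_asymp : exists2 C : R, 0 <= C & forall p n : nat, (0 < p)%N -> (p <= n)%N ->
  `| \sum_(x : {ffun 'I_N -> 'I_(p + n)} | alternating x) walk_wt mom x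
     - 2 * ((~~ odd m)%:R * cycle_wt * (p * n)%:R ^+ m./2) | <= C * (p * n ^ (m - 2))%:R.
Proof.
pose B := 1 + \sum_(j < N.+1) `|mom j|.
have B1 : 1 <= B by rewrite lerDl sumr_ge0.
have B0 : 0 <= B by apply: le_trans B1.
have momB j : (j <= N)%N -> `|mom j| <= B.
  move=> jN; rewrite /B (bigD1 (Ordinal (jN : (j < N.+1)%N))) //= addrCA lerDl.
  by rewrite addr_ge0 ?sumr_ge0.
(* Bounds a walk weight plus the cycle weight subtracted from it. *)
pose K := 2 ^+ N * B ^+ N + `|cycle_wt|.
have K0 : 0 <= K by rewrite addr_ge0 // mulr_ge0 // exprn_ge0.
exists (K * (2 * N ^ N)%:R); first by rewrite mulr_ge0.
move=> p n p0 pn.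
(* Written as a sum over the same walks, the main term cancels walk by walk except on walks with
   fewer than [m] vertices. *)
have -> : 2 * ((~~ odd m)%:R * cycle_wt * (p * n)%:R ^+ m./2) =
  \sum_(x : {ffun 'I_N -> 'I_(p + n)} | alternating x)
    (~~ odd m && (x \in periodic_walks p n k m))%:R * cycle_wt.
  case em : (~~ odd m); last first.
    by rewrite mul0r mul0r mulr0 big1 // => x _; rewrite mul0r.
  rewrite mul1r -mulr_suml -natr_sum mulrCA mulrC -natrX -natrM; congr (_%:R * _).
  rewrite -(card_periodic_walks p n Nm m_ge2 em) -sum1_card big_mkcond [RHS]big_mkcond /=.
  by apply: eq_bigr => x _; rewrite inE; case: alternating.
rewrite -sumrB.
rewrite (bigID (fun x : {ffun 'I_N -> 'I_(p + n)} => (#|[set x s | s : 'I_N]| < m)%N)) /=.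
rewrite [X in _ + X]big1 ?addr0; last first.
  by move=> x /andP[ax]; rewrite -leqNgt => mV; rewrite (walk_wt_large ax mV) subrr.
apply: le_trans (ler_norm_sum _ _ _) _.
apply: (@le_trans _ _ (\sum_(x in [set x : {ffun 'I_N -> 'I_(p + n)} |
    alternating x && (#|[set x s | s : 'I_N]| < m)%N]) K)).
  rewrite [leRHS](eq_bigl (fun x : {ffun 'I_N -> 'I_(p + n)} =>
     alternating x && (#|[set x s | s : 'I_N]| < m)%N)); last by move=> x; rewrite inE.
  apply: ler_sum => x _; apply: le_trans (ler_normB _ _) _; apply: lerD.
    exact: walk_wt_bound.
  by case: (_ && _); rewrite ?mul1r ?mul0r ?normr0.
rewrite sumr_const -[leLHS]mulr_natr -[leRHS]mulrA -natrM; apply: ler_wpM2l => //; rewrite ler_nat.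
exact: card_small_walk.
Qed.

End WalkSum.

(** * Binomial identities *)

Section Binomials.
Variables (R : realFieldType).

(* Equal to the Narayana number ['C(l, b) 'C(l, b - 1) / l], see [narayanaE]. *)
Definition narayana (l b : nat) : R :=
  ('C(l, b) * 'C(l.-1, b.-1))%:R - ('C(l, b.-1) * 'C(l, b))%:R
  + ('C(l, b.-1) * 'C(l.-1, b.-1))%:R.

Definition projective (l b : nat) : R :=
  \sum_(j < b) ('C(l, b - j.+1) * 'C(l, b + j.+1))%:R.

(** Vandermonde's sum for ['C(2 * l, 2 * b)] is symmetric about its middle term ['C(l, b) ^ 2];
    [projective] is either half. *)
Lemma projectiveE l b : 2 * projective l b + 'C(l, b)%:R ^+ 2 = 'C(2 * l, 2 * b)%:R.
Proof.
rewrite mul2n -addnn -binomial.Vandermonde natr_sum.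
rewrite -(big_mkord xpredT (fun i => ('C(l, i) * 'C(l, 2 * b - i))%:R)).
rewrite (@big_cat_nat _ _ _ b) //=; last by lia.
rewrite (@big_ltn _ _ _ b) /=; last by lia.
have -> : (2 * b - b = b)%N by lia.
rewrite [in RHS]natrM -expr2 [RHS]addrCA [LHS]addrC; congr (_ + _).
rewrite mulr_natl mulr2n; congr (_ + _).
  rewrite big_mkord (reindex_inj rev_ord_inj) /=; apply: eq_bigr => j _.
  by rewrite (_ : 2 * b - (b - j.+1) = b + j.+1)%N //; have := ltn_ord j; lia.
rewrite -{1}[b.+1]add0n big_addn (_ : (2 * b).+1 - b.+1 = b)%N; last by lia.
rewrite big_mkord; apply: eq_bigr => j _; rewrite mulnC.
by rewrite (_ : j + b.+1 = b + j.+1)%N 1?(_ : 2 * b - (b + j.+1) = b - j.+1)%N //; lia.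
Qed.

Lemma bin_diag_natr l b : (0 < l)%N -> (0 < b)%N ->
  l%:R * 'C(l.-1, b.-1)%:R = b%:R * 'C(l, b)%:R :> R.
Proof.
by case: l b => [//|l] [//|b] _ _ /=; rewrite -!natrM mul_bin_diag.
Qed.

Lemma bin_left_natr l b : (0 < b)%N -> (b <= l)%N ->
  b%:R * 'C(l, b)%:R = (l.+1 - b)%:R * 'C(l, b.-1)%:R :> R.
Proof.
case: b => [//|b] _ bl /=; rewrite -!natrM mul_bin_left.
by rewrite subSS.
Qed.

Lemma narayanaE l b : (0 < b)%N -> (b <= l)%N ->
  l%:R * narayana l b = 'C(l, b)%:R * 'C(l, b.-1)%:R.
Proof.
move=> b0 bl; have l0 : (0 < l)%N by lia.
rewrite /narayana !natrM.
have h1 := bin_diag_natr l0 b0; have h2 := bin_left_natr b0 bl.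
have h3 : (l.+1 - b)%:R = l%:R + 1 - b%:R :> R by rewrite natrB ?natr1 //; exact: leqW.
move: h1 h2; rewrite h3; move: ('C(l, b)%:R) ('C(l, b.-1)%:R) ('C(l.-1, b.-1)%:R) => x y z h1 h2.
have -> : l%:R * (x * z - y * x + y * z) = x * (l%:R * z) - l%:R * x * y + y * (l%:R * z).
  by ring.
by rewrite h1 {1}h2; ring.
Qed.

(** The factorials are those that turn ['C(p, b) * 'C(n - b, l + 1 - b)] into falling factorials. *)
Lemma narayana_fact l b : (0 < b)%N -> (b <= l)%N ->
  (l`! * 'C(l.-1, b.-1))%:R = narayana l b * (b`! * (l.+1 - b)`!)%:R.
Proof.
move=> b0 bl; have l0 : (0 < l)%N by lia.
have ln0 : l%:R != 0 :> R by rewrite pnatr_eq0 -lt0n.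
apply: (mulfI ln0); rewrite mulrA narayanaE // -!natrM; congr (_%:R).
have bf : ('C(l, b.-1) * (b.-1`! * (l - b.-1)`!) = l`!)%N by apply: bin_fact; lia.
have e : (l.+1 - b = l - b.-1)%N by lia.
rewrite e mulnCA -bf (_ : l * 'C(l.-1, b.-1) = b * 'C(l, b))%N; last first.
  by case: l l0 {bl ln0 bf e} => [//|l] _; case: b b0 => [//|b] _ /=; rewrite mul_bin_diag.
by case: b b0 {bl bf e} => [//|b] _ /=; rewrite factS; ring.
Qed.

(** The left side is what the leading terms lose at the next order when falling factorials replace
    powers. The right side accounts for [(2 b - 1) 'C(l, b)^2] in the theorem. *)
Lemma narayana_sub_identity l b : (0 < b)%N -> (b <= l)%N ->
  'C(b.+1, 2)%:R * narayana l b.+1 + (b * (l.+1 - b) + 'C(l.+1 - b, 2))%:R * narayana l b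
  = b%:R * 'C(l, b)%:R ^+ 2.
Proof.
move=> b0 bl; have l0 : (0 < l)%N by lia.
have ln0 : l%:R != 0 :> R by rewrite pnatr_eq0 -lt0n.
have two0 : (2 : R) != 0 by rewrite pnatr_eq0.
have bin2r j : 2 * 'C(j.+1, 2)%:R = j.+1%:R * j%:R :> R.
  by rewrite -!natrM bin2 /= mul2n halfK oddM /= andNb subn0.
have nS : (b.+1%:R * 'C(l, b.+1)%:R = (l - b)%:R * 'C(l, b)%:R :> R).
  by rewrite -!natrM mul_bin_left.
have nz : l%:R * narayana l b.+1 = 'C(l, b.+1)%:R * 'C(l, b)%:R.
  have [lt|ge] := ltnP b l; first by rewrite narayanaE.
  rewrite /narayana /= bin_small; last by lia.
  by rewrite (@bin_small l.-1 b) ?mul0n ?muln0 ?mul0r; [ring|lia].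
apply: (mulfI (mulf_neq0 two0 ln0)).
have lb : (l.+1 - b)%:R = (l - b)%:R + 1 :> R by rewrite subSn // natr1.
have h2 := bin_left_natr b0 bl.
have b2 := bin2r b; have c2 : 2 * 'C(l.+1 - b, 2)%:R = (l.+1 - b)%:R * (l - b)%:R :> R.
  by rewrite subSn // bin2r.
have ny := narayanaE b0 bl.
rewrite natrD natrM; rewrite lb in h2 c2 *.
have Ll : l%:R = (l - b)%:R + b%:R :> R by rewrite -natrD subnK.
move: ny nz nS h2 b2 c2 Ll; rewrite -natr1.
move: (narayana l b) (narayana l b.+1) ('C(l, b)%:R) ('C(l, b.-1)%:R) ('C(l, b.+1)%:R)
  ('C(b.+1, 2)%:R) ('C(l.+1 - b, 2)%:R) ((l - b)%:R) (b%:R) (l%:R)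
  => u v x y z s t d B L hu hv nS h2 hs ht hL.
have -> : 2 * L * (s * v + (B * (d + 1) + t) * u) =
  (2 * s) * (L * v) + (2 * B * (d + 1) + 2 * t) * (L * u) by ring.
rewrite hs ht hu hv.
have -> : (B + 1) * B * (z * x) + (2 * B * (d + 1) + (d + 1) * d) * (x * y) =
  B * x * ((B + 1) * z) + (2 * B + d) * x * ((d + 1) * y) by ring.
by rewrite nS -h2 hL; ring.
Qed.

Lemma sum_shift (l d : nat) (g : nat -> R) : (forall j, (l < j)%N -> g j = 0) ->
  \sum_(i < l.+1) g (i + d)%N = \sum_(j < l.+1 | (d <= j)%N) g j.
Proof.
move=> g0; rewrite -(big_mkord xpredT (fun i => g (i + d)%N)).
rewrite -(big_mkord (fun j => d <= j)%N g).
transitivity (\sum_(d <= j < (l.+1 + d)%N) g j).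
  by rewrite -{2}[d]add0n big_addn addnK.
have [dl|ld] := leqP d l.+1.
  rewrite (@big_cat_nat _ _ _ l.+1 d) ?leq_addr //= [X in _ + X]big_nat [X in _ + X]big1 ?addr0; last first.
    by move=> j /andP[lj _]; apply: g0.
  rewrite (@big_cat_nat _ _ _ d 0 l.+1) //= [X in _ = X + _]big_nat_cond [X in _ = X + _]big1 ?add0r; last first.
    by move=> j /andP[/andP[_ jd] dj]; move: jd; rewrite ltnNge dj.
  by rewrite big_nat_cond [RHS]big_nat_cond; apply: eq_bigl => j; case: (d <= j)%N; rewrite ?andbF.
rewrite big_nat big1; last by move=> j /andP[dj _]; apply: g0; lia.
by rewrite big_nat_cond big1 // => j; lia.
Qed.

Lemma sum_ltn_ord (l j : nat) (g : nat -> R) : (j <= l)%N ->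
  \sum_(i < l | (i < j)%N) g i = \sum_(i < j) g i.
Proof.
move=> jl; rewrite -(big_mkord xpredT g) -(big_mkord (fun i => i < j)%N g).
rewrite (@big_cat_nat _ _ _ j 0 l) //= [X in _ + X]big_nat_cond [X in _ + X]big1 ?addr0; last first.
  by move=> i; lia.
by rewrite big_nat_cond [RHS]big_nat_cond; apply: eq_bigl => i; case: (i < j)%N.
Qed.

Lemma alternating_bin_sum l j :
  \sum_(i < j.+1) (-1) ^+ (j - i) * 'C(l.+1, i)%:R = 'C(l, j)%:R :> R.
Proof.
elim: j => [|j IH]; first by rewrite big_ord1 subnn expr0 mul1r !bin0.
rewrite big_ord_recr /= subnn expr0 mul1r binS natrD.
have -> : \sum_(i < j.+1) (-1) ^+ (j.+1 - i) * 'C(l.+1, i)%:R = - 'C(l, j)%:R :> R.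
  rewrite -IH -sumrN; apply: eq_bigr => i _.
  by rewrite subSn ?exprS; [ring|rewrite -ltnS].
by ring.
Qed.

Variables (a b : R).

(** With [j = i + m] the inner sum is an alternating partial row of Pascal's triangle. *)
Lemma ncoef_alternating l : (0 < l)%N ->
  \sum_(m < l.+1) ncoef a b l m * (- b) ^+ m =
  \sum_(j < l.+1) ('C(l, j) * 'C(l.-1, j))%:R * b ^+ j * a ^+ (l - j).
Proof.
case: l => [//|l] _.
pose f (i j : nat) : R :=
  (-1) ^+ (j - i) * ('C(l.+1, i) * 'C(l.+1, j))%:R * b ^+ j * a ^+ (l.+1 - j).
transitivity (\sum_(i < l.+2) \sum_(m < l.+2) f i (m + i)%N).
  rewrite exchange_big; apply: eq_bigr => m _; rewrite /ncoef mulr_suml.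
  apply: eq_bigr => i _; rewrite /f addnK [(m + i)%N]addnC [(- b) ^+ m]exprNn exprD; ring.
transitivity (\sum_(i < l.+2) \sum_(j < l.+2 | (i <= j)%N) f i j).
  apply: eq_bigr => i _; apply: (@sum_shift l.+1 i (f i)) => j lj.
  by rewrite /f [X in (_ * X)%N]bin_small // muln0; ring.
rewrite (exchange_big_dep xpredT) //=; apply: eq_bigr => j _.
rewrite (@sum_ltn_ord l.+2 j.+1 (f^~ j)) //.
rewrite [RHS](_ : _ = 'C(l, j)%:R * ('C(l.+1, j)%:R * b ^+ j * a ^+ (l.+1 - j))); last first.
  by rewrite natrM; ring.
by rewrite -alternating_bin_sum mulr_suml; apply: eq_bigr => i _; rewrite /f natrM; ring.
Qed.

(** Collects all that the walk sums for [m >= 2] leave out. Extending the explicit term to [m = 0]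
    and [m = 1] changes the values there, [b] and [- b^2], into [a] and [- a b]. *)
Lemma planar_sum l : (0 < l)%N ->
  a * ncoef a b l 0 - a * b * ncoef a b l 1
    - (a - b) * (\sum_(m < l.+1) ncoef a b l m * (- b) ^+ m) =
  \sum_(i < l) narayana l i.+1 * b ^+ i.+1 * a ^+ (l - i).
Proof.
move=> l0; rewrite ncoef_alternating // mulrBl.
have E0 (c : nat -> R) : a * \sum_(j < l.+1) c j * b ^+ j * a ^+ (l - j) =
    c 0%N * a ^+ l.+1 + \sum_(i < l) c i.+1 * b ^+ i.+1 * a ^+ (l - i).
  rewrite big_ord_recl /= subn0 mulrDr mulr_sumr; congr (_ + _).
    by rewrite exprS; ring.
  apply: eq_bigr => i _; rewrite /bump /= (_ : (l - i = (l - i.+1).+1)%N).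
    by rewrite [a ^+ (_.+1)]exprS; ring.
  by have := ltn_ord i; lia.
have E1 (c : nat -> R) : c l = 0 -> b * \sum_(j < l.+1) c j * b ^+ j * a ^+ (l - j) =
    \sum_(i < l) c i * b ^+ i.+1 * a ^+ (l - i).
  move=> cl; rewrite big_ord_recr /= cl !mul0r addr0 mulr_sumr.
  by apply: eq_bigr => i _; rewrite exprS; ring.
have -> : a * ncoef a b l 0 = 1 * a ^+ l.+1 +
    \sum_(i < l) ('C(l, i.+1) * 'C(l, i.+1))%:R * b ^+ i.+1 * a ^+ (l - i).
  have /= := E0 (fun j => ('C(l, j) * 'C(l, j))%:R); rewrite !bin0 muln1 => <-; congr (_ * _).
  by apply: eq_bigr => i _; rewrite !addn0.
rewrite (E0 (fun j => ('C(l, j) * 'C(l.-1, j))%:R)) (E1 (fun j => ('C(l, j) * 'C(l.-1, j))%:R)); last first.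
  by rewrite [X in (_ * X)%N]bin_small ?muln0 //; lia.
have -> : a * b * ncoef a b l 1 = \sum_(i < l) ('C(l, i) * 'C(l, i.+1))%:R * b ^+ i.+1 * a ^+ (l - i).
  rewrite /ncoef big_ord_recr /= addn1 (@bin_small l l.+1) // muln0 !mul0r addr0 mulr_sumr.
  apply: eq_bigr => i _; rewrite addn1 (_ : (l - i = (l - i.+1).+1)%N).
    by rewrite !exprS; ring.
  by have := ltn_ord i; lia.
rewrite !bin0 muln1 opprB addrA.
transitivity (\sum_(i < l) ('C(l, i.+1) * 'C(l, i.+1))%:R * b ^+ i.+1 * a ^+ (l - i)
  - \sum_(i < l) ('C(l, i) * 'C(l, i.+1))%:R * b ^+ i.+1 * a ^+ (l - i)
  + \sum_(i < l) ('C(l, i) * 'C(l.-1, i))%:R * b ^+ i.+1 * a ^+ (l - i)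
  - \sum_(i < l) ('C(l, i.+1) * 'C(l.-1, i.+1))%:R * b ^+ i.+1 * a ^+ (l - i)); first by ring.
rewrite -!sumrN -!big_split /=; apply: eq_bigr => i _.
rewrite /narayana /=; have -> : 'C(l, i.+1)%N = ('C(l.-1, i.+1) + 'C(l.-1, i))%N.
  by rewrite -{1}(prednK l0) binS.
by rewrite !natrM !natrD; ring.
Qed.

(** The total of the doubled cycles, one for each even [m = 2 (h + 1)]. *)
Lemma projective_sum l :
  \sum_(h < l) ncoef a b l (2 * h.+1) * (a * b) ^+ h.+1 =
  \sum_(i < l) projective l i.+1 * b ^+ i.+1 * a ^+ (l - i.+1).
Proof.
pose g h j := ('C(l, j - h.+1) * 'C(l, j + h.+1))%:R * b ^+ j * a ^+ (l - j) : R.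
transitivity (\sum_(h < l) \sum_(i < l.+1) g h (i + h.+1)%N).
  apply: eq_bigr => h _; rewrite /ncoef mulr_suml; apply: eq_bigr => i _.
  rewrite /g addnK (_ : (i + h.+1 + h.+1 = i + 2 * h.+1)%N); last by lia.
  have [le|lt] := leqP (i + 2 * h.+1)%N l; last first.
    by rewrite [X in (_ * X)%N]bin_small // muln0; ring.
  rewrite (_ : (l - (i + h.+1) = l - (i + 2 * h.+1) + h.+1)%N); last by lia.
  by rewrite !exprD exprMn; ring.
transitivity (\sum_(h < l) \sum_(j < l.+1 | (h.+1 <= j)%N) g h j).
  apply: eq_bigr => h _; apply: (@sum_shift l h.+1 (g h)) => j lj.
  by rewrite /g [X in (_ * X)%N]bin_small ?muln0 ?mul0r //; lia.
rewrite (exchange_big_dep xpredT) //= big_ord_recl /= big_pred0 ?add0r //.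
apply: eq_bigr => i _; rewrite /bump /= /projective.
rewrite (@sum_ltn_ord l i.+1 (fun h => g h i.+1)) //.
by rewrite !mulr_suml; apply: eq_bigr.
Qed.

Lemma kurtosis_sum l :
  ncoef a b l 2 * (a * b) =
  \sum_(i < l) ('C(l, i) * 'C(l, i.+2))%:R * b ^+ i.+1 * a ^+ (l - i.+1).
Proof.
rewrite /ncoef big_ord_recr /= (@bin_small l (l + 2)) ?muln0 ?mul0r ?addr0; last by lia.
rewrite mulr_suml; apply: eq_bigr => i _; rewrite addn2.
have [le|lt] := leqP i.+2 l; last by rewrite (bin_small lt) muln0; ring.
rewrite (_ : (l - i.+1 = (l - i.+2).+1)%N); last by lia.
by rewrite !exprS; ring.
Qed.

End Binomials.

(** * Falling factorials *)

Section FallingFactorials.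
Variables (R : realFieldType).

Lemma approx_mul (A B x y u v e1 e2 : R) :
  `|A - (x - y)| <= e1 -> `|B - (u - v)| <= e2 ->
  `|A * B - (x * u - y * u - x * v)|
    <= e1 * (`|u| + `|v| + e2) + (`|x| + `|y|) * e2 + `|y * v|.
Proof.
move=> h1 h2.
have -> : A * B - (x * u - y * u - x * v) =
   (A - (x - y)) * B + (x - y) * (B - (u - v)) + y * v by ring.
apply: le_trans (ler_normD _ _) _; rewrite lerD2r.
apply: le_trans (ler_normD _ _) _; rewrite !normrM; apply: lerD; apply: ler_pM => //.
  have -> : B = u - v + (B - (u - v)) by ring.
  by apply: le_trans (ler_normD _ _) _; apply: lerD => //; apply: ler_normB.
exact: ler_normB.
Qed.

Lemma natr_ffactSr (p b : nat) : (p ^_ b.+1)%:R = (p ^_ b)%:R * (p%:R - b%:R) :> R.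
Proof.
rewrite ffactnSr natrM; have [bp|pb] := leqP b p; first by rewrite natrB.
by rewrite ffact_small // !mul0r.
Qed.

Lemma bin2_pred_expr (b : nat) (x : R) :
  'C(b, 2)%:R * x ^+ b.-1 * x = 'C(b, 2)%:R * x ^+ b.
Proof. by case: b => [|b]; rewrite ?mul0r // exprSr mulrA. Qed.

(** One factor [p] is kept and the others are traded for [n], to match the error scale [p / n^2]. *)
Lemma exprn_le_div (p n b : nat) : (0 < p)%N -> (p <= n)%N -> (0 < b)%N ->
  (p%:R : R) ^+ b <= p%:R * n%:R ^+ b / n%:R.
Proof.
move=> p0 pn; case: b => [//|b] _; have n0 : (n%:R : R) != 0 by rewrite pnatr_eq0; lia.
rewrite !exprS.
have -> : p%:R * (n%:R * n%:R ^+ b) / n%:R = p%:R * n%:R ^+ b :> R by field.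
by rewrite ler_wpM2l // lerXn2r ?nnegrE ?ler_nat.
Qed.

Lemma bin2_exprn_le (p n b : nat) : (0 < p)%N -> (p <= n)%N ->
  'C(b, 2)%:R * (p%:R : R) ^+ b.-1 <= 'C(b, 2)%:R * (p%:R * n%:R ^+ b / n%:R ^+ 2).
Proof.
move=> p0 pn; have n0 : (n%:R : R) != 0 by rewrite pnatr_eq0; lia.
case: b => [|[|b]]; [by rewrite bin_small // !mul0r|by rewrite bin_small // !mul0r|].
apply: ler_wpM2l => //=.
have -> : p%:R * n%:R ^+ b.+2 / n%:R ^+ 2 = p%:R * n%:R ^+ b :> R.
  by rewrite !exprS; field.
by rewrite exprS ler_wpM2l // lerXn2r ?nnegrE ?ler_nat.
Qed.

(** The next factor [p - b] scales the old error by at most [(b + 1) n] and creates the new error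
    ['C(b, 2) b p^(b-1)], again of the required order. *)
Lemma ffact_approx (b : nat) : exists2 K : R, 0 <= K & forall p n : nat,
  (0 < p)%N -> (p <= n)%N ->
  `|(p ^_ b)%:R - (p%:R ^+ b - 'C(b, 2)%:R * p%:R ^+ b.-1)|
    <= K * (p%:R * n%:R ^+ b / n%:R ^+ 3).
Proof.
elim: b => [|b [K K0 IH]].
  by exists 0 => // p n _ _; rewrite ffactn0 expr0 mul0r subr0 subrr normr0 mul0r.
exists (K * (b%:R + 1) + 'C(b, 2)%:R * b%:R) => [|p n p0 pn].
  by rewrite addr_ge0 ?mulr_ge0 ?addr_ge0.
have n1 : 1 <= n%:R :> R by rewrite ler1n; lia.
have n0 : (n%:R : R) != 0 by rewrite pnatr_eq0; lia.
have {IH} := IH p n p0 pn.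
rewrite natr_ffactSr; set A := (p ^_ b)%:R.
set e := p%:R * n%:R ^+ b / n%:R ^+ 3 => hA.
have -> : p%:R * n%:R ^+ b.+1 / n%:R ^+ 3 = n%:R * e by rewrite /e exprS; field.
have e0 : 0 <= e by rewrite /e mulr_ge0 ?invr_ge0 ?exprn_ge0 ?mulr_ge0 ?exprn_ge0.
have -> : A * (p%:R - b%:R) - (p%:R ^+ b.+1 - 'C(b.+1, 2)%:R * p%:R ^+ b.+1.-1) =
  (A - (p%:R ^+ b - 'C(b, 2)%:R * p%:R ^+ b.-1)) * (p%:R - b%:R)
  + 'C(b, 2)%:R * p%:R ^+ b.-1 * b%:R.
  have := bin2_pred_expr b p%:R.
  rewrite binS bin1 natrD /= exprS => h.
  have -> : ('C(b, 2)%:R + b%:R) * p%:R ^+ b = 'C(b, 2)%:R * p%:R ^+ b.-1 * p%:R + b%:R * p%:R ^+ b :> R.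
    by rewrite h; ring.
  by ring.
rewrite [leRHS]mulrDl; apply: le_trans (ler_normD _ _) _; apply: lerD.
  rewrite normrM (_ : K * _ * _ = (K * e) * ((b%:R + 1) * n%:R)); last by ring.
  apply: ler_pM => //.
  apply: le_trans (ler_normB _ _) _; rewrite !normr_nat.
  have : (p%:R : R) <= n%:R by rewrite ler_nat.
  have : 0 <= (b%:R : R) by [].
  by move=> ? ?; nra.
rewrite ger0_norm ?mulr_ge0 ?exprn_ge0 // [leLHS]mulrC.
rewrite (_ : 'C(b, 2)%:R * _ * _ = b%:R * ('C(b, 2)%:R * (n%:R * e))); last by ring.
apply: ler_wpM2l => //; apply: le_trans (bin2_exprn_le b p0 pn) _.
rewrite (_ : p%:R * _ / _ = n%:R * e) // /e; field.
by rewrite n0.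
Qed.

Lemma ffact_sub_approx (b c : nat) : exists2 K : R, 0 <= K & forall n : nat,
  (0 < n)%N -> (b <= n)%N ->
  `|((n - b) ^_ c)%:R - (n%:R ^+ c - (b * c + 'C(c, 2))%:R * n%:R ^+ c.-1)|
    <= K * (n%:R ^+ c / n%:R ^+ 2).
Proof.
elim: c => [|c [K K0 IH]].
  by exists 0 => // n _ _; rewrite ffactn0 expr0 muln0 mul0r subr0 subrr normr0 mul0r.
pose al : R := (b * c + 'C(c, 2))%:R.
exists (K * (b%:R + c%:R + 1) + al * (b%:R + c%:R)) => [|n n_gt0 bn].
  by rewrite addr_ge0 ?mulr_ge0 ?addr_ge0 // /al.
have n1 : 1 <= n%:R :> R by rewrite ler1n.
have n0 : (n%:R : R) != 0 by rewrite pnatr_eq0; lia.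
have {IH} := IH n n_gt0 bn; rewrite -/al.
rewrite natr_ffactSr natrB //; set A := ((n - b) ^_ c)%:R.
set e := n%:R ^+ c / n%:R ^+ 2 => hA.
have -> : n%:R ^+ c.+1 / n%:R ^+ 2 = n%:R * e by rewrite /e exprS; field.
have e0 : 0 <= e by rewrite /e mulr_ge0 ?invr_ge0 ?exprn_ge0.
have alX : al * n%:R ^+ c.-1 * n%:R = al * n%:R ^+ c.
  rewrite /al; case: (c) => [|c']; first by rewrite muln0 !mul0r.
  by rewrite exprSr mulrA.
have al0 : 0 <= al by rewrite /al.
have -> : A * (n%:R - b%:R - c%:R) - (n%:R ^+ c.+1 - (b * c.+1 + 'C(c.+1, 2))%:R * n%:R ^+ c.+1.-1) =
  (A - (n%:R ^+ c - al * n%:R ^+ c.-1)) * (n%:R - b%:R - c%:R)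
  + al * n%:R ^+ c.-1 * (b%:R + c%:R).
  have -> : (b * c.+1 + 'C(c.+1, 2))%:R = al + b%:R + c%:R :> R.
    by rewrite /al binS bin1 mulnS !natrD; ring.
  have -> : (al + b%:R + c%:R) * n%:R ^+ c.+1.-1 = al * n%:R ^+ c.-1 * n%:R + (b%:R + c%:R) * n%:R ^+ c.
    by rewrite alX /=; ring.
  by rewrite exprS; ring.
rewrite [leRHS]mulrDl; apply: le_trans (ler_normD _ _) _; apply: lerD.
  rewrite normrM (_ : K * _ * _ = (K * e) * ((b%:R + c%:R + 1) * n%:R)); last by ring.
  apply: ler_pM => //.
  have h1 : 0 <= (b%:R : R) by []. have h2 : 0 <= (c%:R : R) by [].
  rewrite ler_norml; apply/andP; split; nra.
rewrite ger0_norm ?mulr_ge0 ?exprn_ge0 ?addr_ge0 //.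
rewrite mulrAC.
have -> : al * (b%:R + c%:R) * n%:R ^+ c.-1 = (b%:R + c%:R) / n%:R * (al * n%:R ^+ c.-1 * n%:R).
  by field.
rewrite alX le_eqVlt; apply/orP; left; apply/eqP; rewrite /e; field.
by rewrite n0.
Qed.

End FallingFactorials.

Section Negligible.
Variable (R : realFieldType).

(** The scale is [p n^(l-2)], written with a division because [l] may be 1; dividing by [n^l] turns
    it into [p / n^2]. *)
Definition negligible_err (l : nat) (f : nat -> nat -> R) :=
  exists2 K : R, 0 <= K & forall p n : nat, (0 < p)%N -> (p <= n)%N ->
    `|f p n| <= K * (p%:R * n%:R ^+ l / n%:R ^+ 2).

Lemma negligible_errD l f g : negligible_err l f -> negligible_err l g ->
  negligible_err l (fun p n => f p n + g p n).
Proof.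
move=> [K K0 hf] [H H0 hg]; exists (K + H) => [|p n p0 pn]; first exact: addr_ge0.
by apply: le_trans (ler_normD _ _) _; rewrite mulrDl lerD ?hf ?hg.
Qed.

Lemma negligible_errZ l c f : negligible_err l f -> negligible_err l (fun p n => c * f p n).
Proof.
move=> [K K0 hf]; exists (`|c| * K) => [|p n p0 pn]; first exact: mulr_ge0.
by rewrite normrM -[leRHS]mulrA; apply: ler_wpM2l; rewrite ?hf.
Qed.

Lemma negligible_err_sum l (h : nat) (f : nat -> nat -> nat -> R) :
  (forall i, (i < h)%N -> negligible_err l (f i)) ->
  negligible_err l (fun p n => \sum_(i < h) f i p n).
Proof.
elim: h => [|h IH] H.
  by exists 0 => // p n _ _; rewrite big_ord0 normr0 mul0r.
have [K K0 HK] := negligible_errD (IH (fun i hi => H i (leqW hi))) (H h (ltnSn h)).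
by exists K => // p n p0 pn; rewrite big_ord_recr; apply: HK.
Qed.

Lemma bin_prod_approx (b c : nat) : (0 < b)%N -> exists2 K : R, 0 <= K &
  forall p n : nat, (0 < p)%N -> (p <= n)%N ->
  `|('C(p, b) * 'C(n - b, c))%:R * (b`! * c`!)%:R -
    (p%:R ^+ b * n%:R ^+ c - 'C(b, 2)%:R * p%:R ^+ b.-1 * n%:R ^+ c
     - p%:R ^+ b * ((b * c + 'C(c, 2))%:R * n%:R ^+ c.-1))|
  <= K * (p%:R * n%:R ^+ (b + c) / n%:R ^+ 3).
Proof.
move=> b0.
have [K1 K10 h1] := ffact_approx R b.
have [K2 K20 h2] := ffact_sub_approx R b c.
pose be : R := 'C(b, 2)%:R; pose al : R := (b * c + 'C(c, 2))%:R.
have be0 : 0 <= be by []. have al0 : 0 <= al by [].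
pose Ka := K1 * (1 + al + K2) + (1 + be) * K2 + be * al.
have Ka0 : 0 <= Ka by rewrite /Ka !addr_ge0 ?mulr_ge0 ?addr_ge0.
exists (Ka + (1 + be + al) * b%:R ^+ 2) => [|p n p0 pn].
  by rewrite addr_ge0 // mulr_ge0 ?exprn_ge0 ?addr_ge0.
rewrite -/be -/al.
have n_gt0 : (0 < n)%N by lia.
have n1 : 1 <= n%:R :> R by rewrite ler1n.
have np : 0 < n%:R :> R by rewrite ltr0n.
have n0 : (n%:R : R) != 0 by rewrite lt0r_neq0.
set P : R := p%:R; set m : R := n%:R.
have P0 : 0 <= P by [].
pose x := P ^+ b; pose y := be * P ^+ b.-1; pose u := m ^+ c; pose v := al * m ^+ c.-1.
pose q := P * m ^+ b / m.
have q0 : 0 <= q by rewrite /q mulr_ge0 ?invr_ge0 ?mulr_ge0 ?exprn_ge0 // ltW.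
have x0 : 0 <= x by rewrite /x exprn_ge0.
have y0 : 0 <= y by rewrite /y mulr_ge0 ?exprn_ge0.
have u0 : 0 <= u by rewrite /u exprn_ge0 // ltW.
have v0 : 0 <= v by rewrite /v mulr_ge0 ?exprn_ge0 // ltW.
have quu : 0 <= q * u / m ^+ 2.
  by apply: divr_ge0; [exact: mulr_ge0|apply: exprn_ge0; exact: ltW].
have minv : 0 <= m^-1 <= 1 by rewrite invr_ge0 ltW //= invf_le1.
have hx : x <= q by apply: exprn_le_div.
have hy : y <= be * (q / m).
  apply: le_trans (bin2_exprn_le R b p0 pn) _; rewrite le_eqVlt; apply/orP; left; apply/eqP.
  by rewrite /q -/be -/P -/m; field.
have hv : v = al * u / m.
  rewrite /v /al /u; case: (c) => [|c']; first by rewrite muln0 !mul0r.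
  by rewrite exprS /=; field.
have -> : P * m ^+ (b + c) / m ^+ 3 = q * u / m ^+ 2 by rewrite /q /u exprD; field.
have -> : P ^+ b * m ^+ c - be * P ^+ b.-1 * m ^+ c - P ^+ b * (al * m ^+ c.-1) =
   x * u - y * u - x * v by [].
(* If [n < b] the binomial ['C(p, b)] is zero, and the expansion itself is an error:
   [b^2 / n^2 >= 1] pays for it, whence the second part of the constant. *)
have [bn|nb] := leqP b n; last first.
  rewrite (bin_small (leq_ltn_trans pn nb)) mul0n mul0r sub0r normrN.
  have mb : m <= b%:R by rewrite ler_nat ltnW.
  have yq : y <= be * q.
    apply: le_trans hy _; apply: ler_wpM2l => //; rewrite -[leRHS]mulr1; apply: ler_wpM2l => //.
    by case/andP: minv.
  have vu : v <= al * u.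
    rewrite hv -[leRHS]mulr1; apply: ler_wpM2l; first exact: mulr_ge0.
    by case/andP: minv.
  apply: (@le_trans _ _ ((1 + be + al) * q * u)).
    apply: (@le_trans _ _ (x * u + y * u + x * v)).
      rewrite ler_norml; apply/andP; split.
        have : 0 <= x * u by apply: mulr_ge0.
        by lra.
      have : 0 <= y * u by apply: mulr_ge0.
      have : 0 <= x * v by apply: mulr_ge0.
      by lra.
    have -> : (1 + be + al) * q * u = q * u + be * q * u + q * (al * u) by ring.
    by apply: lerD; [apply: lerD; apply: ler_wpM2r|apply: ler_pM].
  apply: (@le_trans _ _ ((1 + be + al) * b%:R ^+ 2 * (q * u / m ^+ 2))).
    have -> : (1 + be + al) * b%:R ^+ 2 * (q * u / m ^+ 2) =
      (1 + be + al) * q * u * (b%:R ^+ 2 / m ^+ 2) by ring.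
    rewrite -[leLHS]mulr1; apply: ler_wpM2l; first by do 2![apply: mulr_ge0 => //]; do 2![apply: addr_ge0 => //].
    rewrite -expr_div_n; apply: exprn_ege1; rewrite ler_pdivlMr; last exact: np.
    by rewrite mul1r.
  apply: ler_wpM2r; last by rewrite lerDr.
  exact: quu.
have {h1}h1 := h1 p n p0 pn; have {h2}h2 := h2 n n_gt0 bn.
have -> : ('C(p, b) * 'C(n - b, c))%:R * (b`! * c`!)%:R = (p ^_ b)%:R * ((n - b) ^_ c)%:R :> R.
  by rewrite -!bin_ffact -!natrM; congr (_%:R); ring.
apply: le_trans (approx_mul h1 h2) _; rewrite -/be -/al -/P -/m -/x -/y -/u -/v.
rewrite (ger0_norm u0) (ger0_norm v0) (ger0_norm x0) (ger0_norm y0) (ger0_norm (mulr_ge0 y0 v0)).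
have -> : K1 * (P * m ^+ b / m ^+ 3) = K1 * (q / m ^+ 2) by rewrite /q; congr (_ * _); field.
apply: (@le_trans _ _ (Ka * (q * u / m ^+ 2))); last first.
  apply: ler_wpM2r; first exact: quu.
  by rewrite lerDl mulr_ge0 ?addr_ge0.
have qm2 : 0 <= q / m ^+ 2 by rewrite divr_ge0 // exprn_ge0 // ltW.
have iv1 : m^-1 <= 1 by case/andP: minv.
have iv2 : (m ^+ 2)^-1 <= 1 by rewrite -exprVn exprn_ile1 // invr_ge0 ltW.
have iv0 : 0 <= (m ^+ 2)^-1 by rewrite invr_ge0 exprn_ge0 // ltW.
have E1 : K1 * (q / m ^+ 2) * (u + v + K2 * (u / m ^+ 2)) <= K1 * (1 + al + K2) * (q * u / m ^+ 2).
  have -> : K1 * (1 + al + K2) * (q * u / m ^+ 2) = K1 * (q / m ^+ 2) * ((1 + al + K2) * u) by ring.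
  apply: ler_wpM2l; first exact: mulr_ge0.
  rewrite hv !mulrDl mul1r; apply: lerD; [apply: lerD => //|].
    by rewrite -[leRHS]mulr1; apply: ler_wpM2l => //; apply: mulr_ge0.
  by rewrite mulrA -[leRHS]mulr1; apply: ler_wpM2l => //; apply: mulr_ge0.
have E2 : (x + y) * (K2 * (u / m ^+ 2)) <= (1 + be) * K2 * (q * u / m ^+ 2).
  have -> : (1 + be) * K2 * (q * u / m ^+ 2) = ((1 + be) * q) * (K2 * (u / m ^+ 2)) by ring.
  apply: ler_wpM2r; first by rewrite !mulr_ge0.
  rewrite mulrDl mul1r; apply: lerD => //; apply: le_trans hy _; apply: ler_wpM2l => //.
  by rewrite -[leRHS]mulr1; apply: ler_wpM2l.
have E3 : y * v <= be * al * (q * u / m ^+ 2).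
  have -> : be * al * (q * u / m ^+ 2) = be * (q / m) * (al * u / m) by field.
  by rewrite -hv; apply: ler_wpM2r.
have -> : Ka * (q * u / m ^+ 2) = K1 * (1 + al + K2) * (q * u / m ^+ 2)
  + (1 + be) * K2 * (q * u / m ^+ 2) + be * al * (q * u / m ^+ 2) by rewrite /Ka; ring.
by apply: lerD; [apply: lerD|].
Qed.

End Negligible.

(** * The two leading orders *)

Section MainTerm.
Variables (R : realFieldType) (m4 : R) (l : nat).
Hypothesis l0 : (0 < l)%N.

Definition leading_part (p n : nat) : R :=
  \sum_(i < l) narayana R l i.+1 * p%:R ^+ i.+1 * n%:R ^+ (l - i).

Definition subleading_part (p n : nat) : R :=
  \sum_(i < l) (projective R l i.+1 + (m4 - 3) * ('C(l, i) * 'C(l, i.+2))%:R)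
     * p%:R ^+ i.+1 * n%:R ^+ (l - i.+1).

Definition main_term (b p n : nat) : R :=
  ('C(p, b) * 'C(n - b, l.+1 - b))%:R * (l`! * 'C(l.-1, b.-1))%:R
  + ('C(p, b) * 'C(n - b, l - b))%:R
    * ((b`! * (l - b)`!)%:R / 2 * ('C(2 * l, 2 * b) + (2 * b - 1) * 'C(l, b) ^ 2)%:R
       + (m4 - 3) * (b < l)%:R * (b`! * (l - b)`! * 'C(l, b.-1) * 'C(l, b.+1))%:R).

(** The first product has total degree [l + 1] and is expanded to two orders; for the second, of
    degree [l], one order is enough. *)
Let err1 i p n : R := ('C(p, i.+1) * 'C(n - i.+1, l - i))%:R * (i.+1`! * (l - i)`!)%:R -
  (p%:R ^+ i.+1 * n%:R ^+ (l - i) - 'C(i.+1, 2)%:R * p%:R ^+ i * n%:R ^+ (l - i)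
   - p%:R ^+ i.+1 * ((i.+1 * (l - i) + 'C(l - i, 2))%:R * n%:R ^+ (l - i).-1)).

Let err2 i p n : R := ('C(p, i.+1) * 'C(n - i.+1, l - i.+1))%:R * (i.+1`! * (l - i.+1)`!)%:R -
  p%:R ^+ i.+1 * n%:R ^+ (l - i.+1).

Let err1_negligible i : (i < l)%N -> negligible_err l (err1 i).
Proof.
move=> il; have [K K0 H] := @bin_prod_approx R i.+1 (l - i) isT.
exists K => // p n p0 pn; apply: le_trans (H p n p0 pn) _.
have n0 : (n%:R : R) != 0 by rewrite pnatr_eq0; lia.
rewrite (_ : (i.+1 + (l - i) = l.+1)%N); last by lia.
rewrite exprS (_ : p%:R * (n%:R * n%:R ^+ l) / n%:R ^+ 3 = p%:R * n%:R ^+ l / n%:R ^+ 2) //.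
by field.
Qed.

Let err2_negligible i : (i < l)%N -> negligible_err l (err2 i).
Proof.
move=> il; have [K K0 H] := @bin_prod_approx R i.+1 (l - i.+1) isT.
pose c := (l - i.+1)%N.
pose be : R := 'C(i.+1, 2)%:R; pose al : R := (i.+1 * c + 'C(c, 2))%:R.
have be0 : 0 <= be by []. have al0 : 0 <= al by [].
exists (K + be + al) => [|p n p0 pn]; first by rewrite !addr_ge0.
have n_gt0 : (0 < n)%N by lia.
have n1 : 1 <= n%:R :> R by rewrite ler1n.
have np : 0 < n%:R :> R by rewrite ltr0n.
have n0 : (n%:R : R) != 0 by rewrite lt0r_neq0.
have {H} := H p n p0 pn; rewrite -/c -/be -/al (_ : (i.+1 + c = l)%N); last by rewrite /c; lia.
rewrite /err2 -/c.
set T := _%:R * _%:R; set q := p%:R * n%:R ^+ l / n%:R ^+ 2 => H.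
have q0 : 0 <= q by rewrite /q divr_ge0 ?mulr_ge0 ?exprn_ge0.
have lE : n%:R ^+ l = n%:R ^+ i.+1 * n%:R ^+ c :> R by rewrite -exprD; congr (_ ^+ _); rewrite /c; lia.
have -> : T - p%:R ^+ i.+1 * n%:R ^+ c =
  (T - (p%:R ^+ i.+1 * n%:R ^+ c - be * p%:R ^+ i.+1.-1 * n%:R ^+ c
      - p%:R ^+ i.+1 * (al * n%:R ^+ c.-1)))
  - (be * p%:R ^+ i.+1.-1 * n%:R ^+ c) - (p%:R ^+ i.+1 * (al * n%:R ^+ c.-1)) by ring.
rewrite !mulrDl.
apply: le_trans (ler_normB _ _) _; apply: lerD; first (apply: le_trans (ler_normB _ _) _; apply: lerD).
- apply: le_trans H _; apply: ler_wpM2l => //.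
  rewrite (_ : p%:R * n%:R ^+ l / n%:R ^+ 3 = q / n%:R); last by rewrite /q; field.
  by rewrite ler_pdivrMr // ler_peMr.
- rewrite ger0_norm ?mulr_ge0 ?exprn_ge0 //.
  have -> : be * q = be * (p%:R * n%:R ^+ i.+1 / n%:R ^+ 2) * n%:R ^+ c.
    by rewrite /q lE; field.
  by apply: ler_wpM2r; [exact: exprn_ge0|exact: bin2_exprn_le].
- rewrite ger0_norm ?mulr_ge0 ?exprn_ge0 //.
  have -> : al * n%:R ^+ c.-1 = al * n%:R ^+ c / n%:R.
    rewrite /al; case: (c) => [|c']; first by rewrite muln0 !mul0r.
    by rewrite exprS /=; field.
  have -> : al * q = (p%:R * n%:R ^+ i.+1 / n%:R) * (al * n%:R ^+ c / n%:R).
    by rewrite /q lE; field.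
  apply: ler_wpM2r; last exact: exprn_le_div.
  by rewrite divr_ge0 ?mulr_ge0 ?exprn_ge0.
Qed.

Let rho i : R := ('C(2 * l, 2 * i.+1) + (2 * i.+1 - 1) * 'C(l, i.+1) ^ 2)%:R / 2
  + (m4 - 3) * ('C(l, i) * 'C(l, i.+2))%:R.

(** The coefficient in the theorem exceeds the subleading one by just the losses of the two falling
    factorials in the leading terms. *)
Let rhoE i : (i < l)%N -> rho i = projective R l i.+1 + (m4 - 3) * ('C(l, i) * 'C(l, i.+2))%:R
  + 'C(i.+2, 2)%:R * narayana R l i.+2
  + (i.+1 * (l - i) + 'C(l - i, 2))%:R * narayana R l i.+1.
Proof.
move=> il; have := @narayana_sub_identity R l i.+1 isT il; rewrite subSS => h.
have e : (2 * i.+1 - 1)%:R = 2 * i.+1%:R - 1 :> R by rewrite natrB // natrM.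
rewrite /rho natrD [((2 * i.+1 - 1) * _)%:R]natrM natrX e -projectiveE -[X in _ = X]addrA h.
by field.
Qed.

Let main_termE i p n : (i < l)%N -> main_term i.+1 p n =
  narayana R l i.+1 * (('C(p, i.+1) * 'C(n - i.+1, l - i))%:R * (i.+1`! * (l - i)`!)%:R)
  + rho i * (('C(p, i.+1) * 'C(n - i.+1, l - i.+1))%:R * (i.+1`! * (l - i.+1)`!)%:R).
Proof.
move=> il; rewrite /main_term subSS; congr (_ + _).
  by rewrite (@narayana_fact R l i.+1) // subSS /=; ring.
have this : (i.+1 < l)%:R * (i.+1`! * (l - i.+1)`! * 'C(l, i.+1.-1) * 'C(l, i.+2))%:R =
   (i.+1`! * (l - i.+1)`!)%:R * ('C(l, i) * 'C(l, i.+2))%:R :> R.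
  have [lt|ge] := ltnP i.+1 l; first by rewrite mul1r -natrM mulnA.
  by rewrite (@bin_small l i.+2) // !muln0 !mulr0.
by rewrite -[(m4 - 3) * _ * _]mulrA this /rho; field.
Qed.

Lemma main_term_expansion : negligible_err l (fun p n =>
  \sum_(i < l) main_term i.+1 p n - (leading_part p n + subleading_part p n)).
Proof.
have H : negligible_err l (fun p n =>
    \sum_(i < l) (narayana R l i.+1 * err1 i p n + rho i * err2 i p n)).
  apply: (@negligible_err_sum R l l (fun i p n =>
    narayana R l i.+1 * err1 i p n + rho i * err2 i p n)) => i il.
  apply: negligible_errD; apply: negligible_errZ.
    exact: err1_negligible.
  exact: err2_negligible.
case: H => K K0 H; exists K => // p n p0 pn; rewrite (_ : _ - _ =
   \sum_(i < l) (narayana R l i.+1 * err1 i p n + rho i * err2 i p n)); first exact: H.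
(* The loss from [p] lowers the power of [p], so it belongs to the next index. The ends match
   because ['C(1, 2)] and [narayana R l l.+1] are zero. *)
have shift : \sum_(i < l) narayana R l i.+1 * 'C(i.+1, 2)%:R * p%:R ^+ i * n%:R ^+ (l - i) =
    \sum_(i < l) narayana R l i.+2 * 'C(i.+2, 2)%:R * p%:R ^+ i.+1 * n%:R ^+ (l - i.+1).
  case: l l0 => [//|l'] _; rewrite big_ord_recl [RHS]big_ord_recr /=.
  rewrite (@bin_small 1 2) // mulr0 !mul0r add0r.
  rewrite [X in _ + X](_ : _ = 0) ?addr0; last first.
    by rewrite /narayana /= !(@bin_small _ l'.+2) // !(@bin_small l' l'.+1) // ?muln0 ?mul0n; ring.
  by apply: eq_bigr => i _.
rewrite /leading_part /subleading_part opprD addrA -!sumrB.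
transitivity (\sum_(i < l) (narayana R l i.+1 * err1 i p n + rho i * err2 i p n
   - narayana R l i.+1 * 'C(i.+1, 2)%:R * p%:R ^+ i * n%:R ^+ (l - i)
   + narayana R l i.+2 * 'C(i.+2, 2)%:R * p%:R ^+ i.+1 * n%:R ^+ (l - i.+1))); last first.
  by rewrite big_split sumrB /= shift subrK.
apply: eq_bigr => i _; have il := ltn_ord i.
rewrite main_termE // /err1 /err2 (rhoE il).
have -> : ((l - i).-1 = l - i.+1)%N by lia.
by ring.
Qed.

End MainTerm.

(** * The mean trace up to a negligible error *)

Section MomentExpansion.
Variables (R : realFieldType) (mom : nat -> R) (l : nat).
Hypotheses (m0 : mom 0%N = 1) (m1 : mom 1%N = 0) (m2 : mom 2%N = 1) (l0 : (0 < l)%N).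

Lemma sum_even (f : nat -> R) (h : nat) : (forall i, (h <= i)%N -> f i = 0) ->
  \sum_(i < h) (~~ odd i)%:R * f i = \sum_(j < h.+1) f (2 * j)%N.
Proof.
move=> f0.
transitivity (\sum_(i < (2 * h.+1)%N) (~~ odd i)%:R * f i).
  rewrite -!(big_mkord xpredT (fun i => (~~ odd i)%:R * f i)).
  rewrite [RHS](@big_cat_nat _ _ _ h) //=; last by lia.
  rewrite [X in _ = _ + X]big_nat [X in _ = _ + X]big1 ?addr0 // => i /andP[hi _].
  by rewrite f0 // mulr0.
elim: h.+1 => [|k IH]; first by rewrite muln0 !big_ord0.
rewrite (_ : 2 * k.+1 = (2 * k).+2)%N; last by lia.
rewrite !big_ord_recr /= IH; by rewrite oddM /= mul0r addr0 mul1r.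
Qed.

Lemma ncoef_bound (m : nat) : exists2 K : R, 0 <= K & forall p n : nat,
  (0 < n)%N -> (p <= n)%N -> (m <= l)%N -> `|ncoef (n%:R : R) p%:R l m| <= K * n%:R ^+ (l - m).
Proof.
exists (\sum_(i < l.+1) ('C(l, i) * 'C(l, i + m))%:R) => [|p n n0 pn ml]; first exact: sumr_ge0.
rewrite ger0_norm; last by apply: sumr_ge0 => i _; rewrite !mulr_ge0 ?exprn_ge0.
rewrite mulr_suml; apply: ler_sum => i _.
have [le|lt] := leqP (i + m) l; last by rewrite (bin_small lt) muln0 !mul0r.
rewrite -mulrA; apply: ler_wpM2l => //.
rewrite (_ : (l - m = i + (l - (i + m)))%N); last by lia.
by rewrite exprD; apply: ler_wpM2r; rewrite ?exprn_ge0 // lerXn2r ?nnegrE ?ler_nat.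
Qed.

(** Here [i] stands for [m = i + 2]; the cases [m = 0, 1] are computed directly. *)
Let walk_total (p n i : nat) : R :=
  \sum_(x : {ffun 'I_(2 * i.+1).+2 -> 'I_(p + n)} | alternating x) walk_wt mom x.

Let cyc i : R := (~~ odd i)%:R * ((1 + (i == 0%N)%:R * (mom 4%N - 3))).

Let walk_total_bound : exists Cf : nat -> R, forall i, 0 <= Cf i /\
  forall p n : nat, (0 < p)%N -> (p <= n)%N ->
  `|walk_total p n i / 2 - cyc i * (p * n)%:R ^+ i./2.+1| <= Cf i * (p * n ^ i)%:R.
Proof.
suff /choice[Cf HC] : forall i, exists K, 0 <= K /\
    forall p n : nat, (0 < p)%N -> (p <= n)%N ->
    `|walk_total p n i / 2 - cyc i * (p * n)%:R ^+ i./2.+1| <= K * (p * n ^ i)%:R by exists Cf.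
move=> i; have Nm : ((2 * i.+1).+2 = 2 * i.+2)%N by lia.
have [K K0 H] := walk_sum_asymp m0 m1 m2 Nm isT.
exists K; split=> // p n p0 pn; have := H p n p0 pn.
rewrite -/(walk_total p n i) /= negbK subSS subSS subn0 /cycle_wt /cyc.
have -> : (if i.+2 == 2%N then mom 4%N - 2 else 1) = 1 + (i == 0%N)%:R * (mom 4%N - 3).
  by rewrite !eqSS; case: (i == 0%N) => /=; rewrite ?mulr1n ?mulr0n; ring.
set y := _ * _ ^+ _ => h.
have -> : walk_total p n i / 2 - y = (walk_total p n i - 2 * y) / 2 by field.
rewrite normrM (ger0_norm (_ : 0 <= 2^-1)) //; apply: le_trans h.
by rewrite ler_piMr // invf_le1 // ler1n.
Qed.

Let subleadingE p n : subleading_part (mom 4%N) l p n =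
  \sum_(i < l.-1) ncoef n%:R p%:R l i.+2 * (cyc i * (p * n)%:R ^+ i./2.+1).
Proof.
rewrite /subleading_part.
transitivity (\sum_(i < l) projective R l i.+1 * p%:R ^+ i.+1 * n%:R ^+ (l - i.+1)
  + (mom 4%N - 3) * (\sum_(i < l) ('C(l, i) * 'C(l, i.+2))%:R * p%:R ^+ i.+1 * n%:R ^+ (l - i.+1))).
  by rewrite mulr_sumr -big_split /=; apply: eq_bigr => i _; ring.
rewrite -(projective_sum (n%:R : R) p%:R l) -(kurtosis_sum (n%:R : R) p%:R l).
pose f i : R := ncoef n%:R p%:R l i.+2 * (p * n)%:R ^+ i./2.+1.
have f0 i : (l.-1 <= i)%N -> f i = 0 by move=> li; rewrite /f ncoef_gt ?mul0r //; lia.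
transitivity (\sum_(i < l.-1) (~~ odd i)%:R * f i
  + (mom 4%N - 3) * (ncoef n%:R p%:R l 2 * (n%:R * p%:R))).
  rewrite (sum_even f0) prednK //; congr (_ + _); apply: eq_bigr => i _.
  rewrite /f (_ : (2 * i)./2 = i); last by rewrite mul2n doubleK.
  by rewrite (_ : (2 * i).+2 = (2 * i.+1)%N) ?natrM ?(mulrC p%:R) //; lia.
have -> : (mom 4%N - 3) * (ncoef n%:R p%:R l 2 * (n%:R * p%:R)) =
  \sum_(i < l.-1) (~~ odd i)%:R * ((nat_of_ord i == 0%N)%:R * (mom 4%N - 3) * f i).
  case E : l.-1 => [|h].
    by rewrite big_ord0 ncoef_gt ?mul0r ?mulr0 //; lia.
  rewrite big_ord_recl /= big1 ?addr0; last by move=> i _; rewrite !mul0r mulr0.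
  by rewrite /f /= expr1 natrM; ring.
rewrite -big_split; apply: eq_bigr => i _; rewrite /f /cyc /=; ring.
Qed.

(** The sequence [M] is constrained only by the identities that the expected traces will satisfy, so
    no probability enters. *)
Lemma moment_expansion : exists2 K : R, 0 <= K & forall p n : nat,
  (0 < p)%N -> (p <= n)%N -> forall M : nat -> R, M 0%N = p%:R -> M 1%N = (p * n)%:R ->
  (forall i, (i.+2 <= l)%N ->
     2 * (cheb n%:R p%:R M i.+2 0 + (n%:R - p%:R) * (- p%:R) ^+ i.+2) = walk_total p n i) ->
  `|M l - (leading_part R l p n + subleading_part (mom 4%N) l p n)|
    <= K * (p%:R * n%:R ^+ l / n%:R ^+ 2).
Proof.
have [Cf HC] := walk_total_bound.
have /choice[Kf HK] : forall m, exists K, 0 <= K /\ forall p n : nat,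
    (0 < n)%N -> (p <= n)%N -> (m <= l)%N -> `|ncoef (n%:R : R) p%:R l m| <= K * n%:R ^+ (l - m).
  by move=> m; have [K K0 H] := ncoef_bound m; exists K.
(* For [m = i + 2], the bound [n^(l-m)] on [ncoef] times the walk error [p n^(m-2)] is
   [p n^(l-2)]. *)
exists (\sum_(i < l.-1) Kf i.+2 * Cf i) => [|p n p0 pn M M0 M1 HM].
  by apply: sumr_ge0 => i _; apply: mulr_ge0; [case: (HK i.+2)|case: (HC i)].
have n_gt0 : (0 < n)%N by lia.
have n0 : (n%:R : R) != 0 by rewrite pnatr_eq0; lia.
have -> : M l - (leading_part R l p n + subleading_part (mom 4%N) l p n) =
  \sum_(i < l.-1) ncoef n%:R p%:R l i.+2 *
     (walk_total p n i / 2 - cyc i * (p * n)%:R ^+ i./2.+1).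
  under eq_bigr do rewrite mulrBr; rewrite sumrB -subleadingE opprD addrA; congr (_ - _).
  rewrite /leading_part -planar_sum // (power_cheb n%:R p%:R M l) M0.
  rewrite [X in (_ - _) * X]big_ord_recl expr0 mulr1 /=.
  case: (l) l0 HM => [//|h] _ HM /=; rewrite big_ord_recl [X in (_ - _) * (_ + X)]big_ord_recl /=.
  have -> : \sum_(i < h) ncoef n%:R p%:R h.+1 (bump 0 i).+1 * cheb n%:R p%:R M (bump 0 i).+1 0 =
     \sum_(i < h) ncoef n%:R p%:R h.+1 i.+2 * (walk_total p n i / 2)
     - (n%:R - p%:R) * \sum_(i < h) ncoef n%:R p%:R h.+1 i.+2 * (- p%:R) ^+ i.+2.
    rewrite mulr_sumr -sumrB; apply: eq_bigr => i _.
    rewrite -[(bump 0 i).+1]/(i.+2) -HM; last exact: ltn_ord.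
    by move: (cheb _ _ _ _ _) ((- p%:R) ^+ _) => c e; field.
    rewrite M1 M0 natrM -[bump 0 0]/1%N.
  have -> : \sum_(i < h) ncoef n%:R p%:R h.+1 (bump 0 (bump 0 i)) * (- p%:R) ^+ bump 0 (bump 0 i) =
    \sum_(i < h) ncoef n%:R p%:R h.+1 i.+2 * (- p%:R) ^+ i.+2 by [].
  by rewrite expr1; ring.
apply: le_trans (ler_norm_sum _ _ _) _; rewrite mulr_suml; apply: ler_sum => i _.
have il : (i.+2 <= l)%N by have := ltn_ord i; lia.
have [Kf0 HKi] := HK i.+2; have [Cf0 HCi] := HC i.
rewrite normrM (_ : Kf i.+2 * Cf i * _ =
   (Kf i.+2 * n%:R ^+ (l - i.+2)) * (Cf i * (p * n ^ i)%:R)).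
  by apply: ler_pM => //; [exact: HKi|exact: HCi].
rewrite natrM natrX (_ : n%:R ^+ l = n%:R ^+ (l - i.+2) * (n%:R ^+ i * n%:R ^+ 2)).
  by field.
by rewrite -!exprD; congr (_ ^+ _); lia.
Qed.

End MomentExpansion.

(** * Independence and product moments *)

Local Open Scope classical_set_scope.
Local Open Scope ring_scope.

Section WeightedIntegral.
Context d (T : measurableType d) (R : realType) (P : probability T R).
Variables (X : T -> R) (mX : measurable_fun setT X).

Import HBNNSimple.

Let mpre (B : set R) : measurable B -> measurable (X @^-1` B).
Proof. by move=> mB; rewrite -[_ @^-1` _]setTI; exact: mX. Qed.

Let integral_weighted_nnsfun (g : T -> R) (c : R) (h : {nnsfun R >-> R}) :
  measurable_fun setT g -> (forall w, 0 <= g w) ->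
  (forall B, measurable B -> (\int[P]_w (\1_B (X w) * g w)%:E = c%:E * P (X @^-1` B))%E) ->
  (\int[P]_w (h (X w) * g w)%:E =
   \sum_(k \in range h) k%:E * (c%:E * P (X @^-1` (h @^-1` [set k]))))%E.
Proof.
move=> mg g0 H.
have mi k : measurable_fun setT (fun w => \1_(h @^-1` [set k]) (X w) : R).
  apply: (measurableT_comp _ mX); exact: measurable_indic.
transitivity (\int[P]_w (\sum_(k \in range h) (k * (\1_(h @^-1` [set k]) (X w) * g w))%:E))%E.
  apply: eq_integral => w _; rewrite fsumEFin //; congr EFin.
  rewrite {1}fimfunE !fsbig_finite //= mulr_suml.
  by apply: eq_bigr => k _; rewrite mulrA.
rewrite ge0_integral_fsum //; last 2 first.
- move=> k; apply/measurable_EFinP; apply: measurable_funM => //.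
  exact: measurable_funM.
- move=> k w _; rewrite mulrA lee_fin; apply: mulr_ge0 => //.
  by have := nnfun_muleindic_ge0 h k (X w); rewrite -EFinM lee_fin.
apply: eq_fsbigr => k; rewrite inE => -[y _ hk].
have k0 : 0 <= k by rewrite -hk.
under eq_integral do rewrite EFinM.
rewrite ge0_integralZl_EFin ?H //.
- by move=> w _; rewrite lee_fin mulr_ge0.
- by apply/measurable_EFinP; exact: measurable_funM.
Qed.

(** From indicators to simple functions to monotone limits; [g] will be the product of the remaining
    independent factors. *)
Lemma integral_weighted_ge0 (g : T -> R) (c : R) (f : R -> R) :
  measurable_fun setT g -> (forall w, 0 <= g w) -> 0 <= c ->
  (forall B, measurable B -> (\int[P]_w (\1_B (X w) * g w)%:E = c%:E * P (X @^-1` B))%E) ->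
  measurable_fun setT f -> (forall x, 0 <= f x) ->
  (\int[P]_w (f (X w) * g w)%:E = c%:E * \int[P]_w (f (X w))%:E)%E.
Proof.
move=> mg g0 c0 H mf f0.
have mEf : measurable_fun setT (EFin \o f) by exact/measurable_EFinP.
pose h := nnsfun_approx measurableT mEf.
have cvh x : EFin \o h^~ x @ \oo --> (f x)%:E.
  by apply: (cvg_nnsfun_approx measurableT mEf) => // y _; rewrite lee_fin.
have ndh x : {homo h^~ x : n m / (n <= m)%N >-> n <= m}.
  by move=> n m nm; exact/lefP/nd_nnsfun_approx.
have mhX n : measurable_fun setT (fun w => h n (X w)).
  by apply: (measurableT_comp _ mX); exact: measurable_funP.
have L (g' : T -> R) : measurable_fun setT g' -> (forall w, 0 <= g' w) ->
    (\int[P]_w (f (X w) * g' w)%:E = limn (fun n => \int[P]_w (h n (X w) * g' w)%:E))%E.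
  move=> mg' g'0; rewrite -monotone_convergence //.
  - apply: eq_integral => w _; apply/esym/cvg_lim => //.
    under eq_fun do rewrite EFinM; rewrite EFinM.
    by apply: cvgeZr => //; exact: cvh.
  - by move=> n; apply/measurable_EFinP; exact: measurable_funM.
  - by move=> n w _; rewrite lee_fin mulr_ge0.
  - by move=> w _ n m nm; rewrite lee_fin ler_wpM2r // ndh.
rewrite L // (_ : (\int[P]_w (f (X w))%:E = \int[P]_w (f (X w) * cst 1 w)%:E)%E); last first.
  by apply: eq_integral => w _; rewrite /= mulr1.
rewrite L // -limeMl //.
  congr (limn _); apply/funext => n /=.
  rewrite (integral_weighted_nnsfun (h n) mg g0 H).
  rewrite (@integral_weighted_nnsfun (cst 1) 1 (h n)) //.
    rewrite ge0_mule_fsumr; last first.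
      move=> k; rewrite mul1e; have [k0|k0] := leP 0 k.
        by apply: mule_ge0 => //; rewrite lee_fin.
      by rewrite preimage_nnfun0 // preimage_set0 measure0 mule0.
    by apply: eq_fsbigr => k _; rewrite mul1e muleCA.
  move=> B mB; under eq_integral do rewrite /= mulr1.
  rewrite mul1e (_ : (fun w => (\1_B (X w))%:E) = fun w => (\1_(X @^-1` B) w)%:E) //.
  by rewrite integral_indic ?setIT //; exact: mpre.
apply: ereal_nondecreasing_is_cvgn => n m nm; apply: ge0_le_integral => //.
- by move=> w _; rewrite lee_fin mulr_ge0.
- by apply/measurable_EFinP; exact: measurable_funM.
- by apply/measurable_EFinP; exact: measurable_funM.
- by move=> w _; rewrite lee_fin ler_wpM2r // ndh.
Qed.

End WeightedIntegral.

Section HasMean.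
Context d (T : measurableType d) (R : realType) (P : probability T R).

(** Bundling integrability with the value lets linearity be applied without side conditions. *)
Definition has_mean (f : T -> R) (r : R) : Prop :=
  P.-integrable setT (EFin \o f) /\ (\int[P]_w (f w)%:E = r%:E)%E.

Lemma has_mean_ext f g r : f =1 g -> has_mean f r -> has_mean g r.
Proof. by move=> /funext ->. Qed.

Lemma has_mean_cst r : has_mean (cst r) r.
Proof.
split; first exact: finite_measure_integrable_cst.
by rewrite -[LHS]/(\int[P]_w (cst r%:E w))%E integral_cst //= probability_setT mule1.
Qed.

Lemma has_meanD f g a b : has_mean f a -> has_mean g b -> has_mean (fun w => f w + g w) (a + b).
Proof.
move=> [fi fe] [gi ge]; split; first exact: (integrableD measurableT fi gi).
under eq_integral do rewrite EFinD.
by rewrite (integralD measurableT fi gi) /= fe ge.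
Qed.

Lemma has_meanZ f a c : has_mean f a -> has_mean (fun w => c * f w) (c * a).
Proof.
move=> [fi fe]; split; first exact: (integrableZl measurableT c fi).
under eq_integral do rewrite EFinM.
by rewrite (integralZl measurableT fi) fe.
Qed.

Lemma has_meanB f g a b : has_mean f a -> has_mean g b -> has_mean (fun w => f w - g w) (a - b).
Proof.
move=> hf /(has_meanZ (-1)) hg; have := has_meanD hf hg.
by rewrite mulN1r; apply: has_mean_ext => w; rewrite mulN1r.
Qed.

Lemma has_mean_sum (J : Type) (s : seq J) (Q : pred J) (f : J -> T -> R) (a : J -> R) :
  (forall j, Q j -> has_mean (f j) (a j)) ->
  has_mean (fun w => \sum_(j <- s | Q j) f j w) (\sum_(j <- s | Q j) a j).
Proof.
move=> H; elim: s => [|j s IH].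
  by rewrite big_nil; apply: has_mean_ext (has_mean_cst 0) => w; rewrite big_nil.
rewrite big_cons; case: ifP => Qj; last first.
  by apply: has_mean_ext IH => w; rewrite big_cons Qj.
by apply: has_mean_ext (has_meanD (H j Qj) IH) => w; rewrite big_cons Qj.
Qed.

Lemma has_mean_unique f a b : has_mean f a -> has_mean f b -> a = b.
Proof. by move=> [_ fa] [_]; rewrite fa => -[]. Qed.

Lemma has_mean_ge0 (f : T -> R) a : measurable_fun setT f -> (forall w, 0 <= f w) ->
  (\int[P]_w (f w)%:E = a%:E)%E -> has_mean f a.
Proof.
move=> mf f0 fa; split=> //; apply/integrableP; split; first exact/measurable_EFinP.
under eq_integral do rewrite /= ger0_norm //.
by rewrite fa ltry.
Qed.

Lemma integrable_has_mean f : P.-integrable setT (EFin \o f) ->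
  has_mean f (fine (\int[P]_w (f w)%:E)).
Proof. by move=> fi; split=> //; rewrite fineK //; exact: (integrable_fin_num measurableT fi). Qed.

End HasMean.

Section Independence.
Context d (T : measurableType d) (R : realType) (P : probability T R).
Variables (I : eqType) (X : I -> T -> R).
Hypotheses (mX : forall i, measurable_fun setT (X i)) (iX : mutually_independent P X).

(** Independence itself is the case of indicators only. The induction trades one indicator at a time
    for a nonnegative function. *)
Lemma indep_prod_ge0 (J1 J2 : seq I) (f : I -> R -> R) (B : I -> set R) (e : I -> R) :
  uniq (J1 ++ J2) -> (forall i, measurable_fun setT (f i)) ->
  {in J1, forall i x, 0 <= f i x} -> (forall i, measurable (B i)) ->
  {in J1, forall i, (\int[P]_w (f i (X i w))%:E = (e i)%:E)%E} ->
  (\int[P]_w (\prod_(i <- J1) f i (X i w) * \prod_(i <- J2) \1_(B i) (X i w))%:E =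
   (\prod_(i <- J1) e i)%:E * \prod_(i <- J2) P (X i @^-1` B i))%E.
Proof.
move=> + mf.
elim: J1 J2 B => [|i J1 IH] J2 B /= uJ f0 mB fe.
  rewrite big_nil mul1e -(iX uJ mB).
  have mI : measurable [set w | forall i, i \in J2 -> B i (X i w)].
    rewrite (_ : [set _ | _] = \bigcap_(i in [set` J2]) (X i @^-1` B i)) //.
    apply: fin_bigcap_measurable => // j _; rewrite -[_ @^-1` _]setTI; exact: mX.
  transitivity (\int[P]_w (\1_[set w | forall i, i \in J2 -> B i (X i w)] w)%:E)%E; last first.
    by rewrite integral_indic ?setIT.
  apply: eq_integral => w _; congr EFin.
  rewrite big_nil mul1r indicE; have [/set_mem h|] := boolP (w \in _).
    rewrite big_seq big1 // => j jJ; rewrite indicE mem_set //; exact: h.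
  move=> /negP h; have [j jJ nB] : exists2 j, j \in J2 & ~ B j (X j w).
    apply: contrapT => hn; apply: h; apply/mem_set => j jJ.
    by apply: contrapT => nB; apply: hn; exists j.
  by rewrite (big_rem j) //= indicE memNset // mul0r.
have [iJ uJ'] := andP uJ; move: iJ; rewrite mem_cat negb_or => /andP[iJ1 iJ2].
pose g w := \prod_(j <- J1) f j (X j w) * \prod_(j <- J2) \1_(B j) (X j w).
have Pfin (J : seq I) : (\prod_(j <- J) P (X j @^-1` B j) =
    (\prod_(j <- J) fine (P (X j @^-1` B j)))%:E)%E.
  rewrite -prodEFin; apply: eq_bigr => j _; rewrite fineK // fin_num_measure //.
  by rewrite -[_ @^-1` _]setTI; exact: mX.
pose c := \prod_(j <- J1) e j * \prod_(j <- J2) fine (P (X j @^-1` B j)).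
have f0' : {in J1, forall i x, 0 <= f i x} by move=> j jJ; apply: f0; rewrite inE jJ orbT.
have fe' : {in J1, forall i, (\int[P]_w (f i (X i w))%:E = (e i)%:E)%E}.
  by move=> j jJ; apply: fe; rewrite inE jJ orbT.
have e0 j : j \in J1 -> 0 <= e j.
  by move=> jJ; rewrite -lee_fin -fe' //; apply: integral_ge0 => w _; rewrite lee_fin f0'.
have c0 : 0 <= c.
  rewrite /c mulr_ge0 //; first by rewrite big_seq; apply: prodr_ge0 => j /e0.
  by apply: prodr_ge0 => j _; rewrite fine_ge0.
have mg : measurable_fun setT g.
  apply: measurable_funM; apply: measurable_prod => j _.
    exact: (measurableT_comp (mf j) (mX j)).
  by apply: (measurableT_comp _ (mX j)); exact: measurable_indic.
have g0 w : 0 <= g w.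
  rewrite mulr_ge0 //; first by rewrite big_seq; apply: prodr_ge0 => j jJ; apply: f0'.
  by apply: prodr_ge0.
have fi0 x : 0 <= f i x by apply: f0; rewrite inE eqxx.
transitivity (\int[P]_w (f i (X i w) * g w)%:E)%E.
  by apply: eq_integral => w _; rewrite big_cons /g mulrA.
rewrite (integral_weighted_ge0 (mX i) mg g0 c0) //; last first.
  (* The induction hypothesis is used with [i] among the indicators, its set being [A]. *)
  move=> A mA; pose B' j := if j == i then A else B j.
  have mB' j : measurable (B' j) by rewrite /B'; case: ifP.
  have uJ2 : uniq (J1 ++ i :: J2).
    by rewrite -cat1s uniq_catCA.
  have B'i : B' i = A by rewrite /B' eqxx.
  have B'J2 j : j \in J2 -> B' j = B j.
    by rewrite /B'; case: eqP => // -> ; rewrite (negPf iJ2).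
  have := IH (i :: J2) B' uJ2 f0' mB' fe'; rewrite big_cons B'i.
  have -> : (\prod_(j <- J2) P (X j @^-1` B' j) = \prod_(j <- J2) P (X j @^-1` B j))%E.
    by apply: eq_big_seq => j jJ; rewrite B'J2.
  rewrite Pfin => h; rewrite /c EFinM -muleA [X in (_ * X)%E]muleC -h.
  apply: eq_integral => w _; congr EFin; rewrite big_cons B'i /g mulrCA; congr (_ * (_ * _)).
  by apply: eq_big_seq => j jJ; rewrite B'J2.
rewrite fe ?inE ?eqxx // big_cons Pfin -!EFinM; congr EFin.
by rewrite /c mulrC mulrA.
Qed.

(** [J2] holds the factors already known to be nonnegative. Each signed factor is split into
    positive and negative parts, which then move to [J2]. *)
Lemma indep_prod (J1 J2 : seq I) (f : I -> R -> R) (e : I -> R) :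
  uniq (J1 ++ J2) -> (forall i, measurable_fun setT (f i)) ->
  {in J2, forall i x, 0 <= f i x} ->
  {in J1 ++ J2, forall i, has_mean P (fun w => f i (X i w)) (e i)} ->
  has_mean P (fun w => \prod_(i <- J1 ++ J2) f i (X i w)) (\prod_(i <- J1 ++ J2) e i).
Proof.
elim: J1 J2 f e => [|i J1 IH] J2 f e /= uJ mf f0 fe.
  apply: has_mean_ge0.
  - by apply: measurable_prod => j _; apply: (measurableT_comp _ (mX j)).
  - by move=> w; rewrite big_seq; apply: prodr_ge0 => j jJ; apply: f0.
  have := @indep_prod_ge0 J2 [::] f (fun=> setT) e.
  rewrite cats0 big_nil mule1 => <- //; last by move=> j jJ; case: (fe j jJ).
  by apply: eq_integral => w _; rewrite big_nil mulr1.
have [iJ uJ'] := andP uJ; move: (iJ); rewrite mem_cat negb_or => /andP[iJ1 iJ2].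
pose fp x := Num.max (f i x) 0; pose fn x := Num.max (- f i x) 0.
have fpn x : f i x = fp x - fn x.
  rewrite /fp /fn; case: (leP (f i x) 0) => h; last by rewrite max_r ?subr0 // oppr_le0 ltW.
  by rewrite max_l ?sub0r ?opprK // oppr_ge0.
have iJ' : i \in i :: J1 ++ J2 by rewrite inE eqxx.
have part (h : R -> R) : measurable_fun setT h -> (forall x, 0 <= h x <= `|f i x|) ->
    exists a, has_mean P (fun w => h (X i w)) a /\
      has_mean P (fun w => h (X i w) * \prod_(j <- J1 ++ J2) f j (X j w))
        (a * \prod_(j <- J1 ++ J2) e j).
  move=> mh hf; have [fi _] := fe i iJ'.
  have hi : P.-integrable setT (EFin \o (fun w => h (X i w))).
    apply: (le_integrable measurableT _ _ fi).
      by apply/measurable_EFinP; exact: (measurableT_comp mh (mX i)).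
    by move=> w _; rewrite /= lee_fin; have /andP[h0 hle] := hf (X i w); rewrite ger0_norm.
  have hm := integrable_has_mean hi; set a := fine _ in hm; exists a; split=> //.
  pose f' j := if j == i then h else f j; pose e' j := if j == i then a else e j.
  have f'E j : j \in J1 ++ J2 -> f' j = f j.
    by rewrite /f'; case: eqP => // ->; rewrite (negPf iJ).
  have e'E j : j \in J1 ++ J2 -> e' j = e j.
    by rewrite /e'; case: eqP => // ->; rewrite (negPf iJ).
  have pm : perm_eq (J1 ++ i :: J2) (i :: J1 ++ J2) by rewrite -cat1s perm_catCA.
  have uJ2 : uniq (J1 ++ i :: J2) by rewrite (perm_uniq pm).
  have mf' j : measurable_fun setT (f' j) by rewrite /f'; case: ifP.
  have f'0 : {in i :: J2, forall j x, 0 <= f' j x}.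
    move=> j; rewrite inE => /predU1P[-> x|jJ x].
      by rewrite /f' eqxx; case/andP: (hf x).
    by rewrite f'E ?mem_cat ?jJ ?orbT //; apply: f0.
  have fe' : {in J1 ++ i :: J2, forall j, has_mean P (fun w => f' j (X j w)) (e' j)}.
    move=> j; rewrite (perm_mem pm) inE => /predU1P[->|jJ].
      by rewrite /f' /e' eqxx.
    by rewrite f'E // e'E //; apply: fe; rewrite inE jJ orbT.
  have := IH _ _ _ uJ2 mf' f'0 fe'.
  rewrite (perm_big _ pm) /= big_cons {1}/e' eqxx.
  rewrite (eq_big_seq e) //; apply: has_mean_ext => w.
  rewrite (perm_big _ pm) /= big_cons {1}/f' eqxx; congr (_ * _).
  by apply: eq_big_seq => j jJ; rewrite f'E.
have [ap [hp hpJ]] : exists a, has_mean P (fun w => fp (X i w)) a /\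
      has_mean P (fun w => fp (X i w) * \prod_(j <- J1 ++ J2) f j (X j w))
        (a * \prod_(j <- J1 ++ J2) e j).
  apply: part; first exact: measurable_maxr.
  move=> x; rewrite /fp; case: (leP (f i x) 0) => h; first by rewrite lexx normr_ge0.
  by rewrite (ltW h) ler_norm.
have [an [hn hnJ]] : exists a, has_mean P (fun w => fn (X i w)) a /\
      has_mean P (fun w => fn (X i w) * \prod_(j <- J1 ++ J2) f j (X j w))
        (a * \prod_(j <- J1 ++ J2) e j).
  apply: part; first by apply: measurable_maxr => //; exact: measurableT_comp.
  move=> x; rewrite /fn; case: (leP (- f i x) 0) => h; first by rewrite lexx normr_ge0.
  by rewrite (ltW h) -normrN ler_norm.
have ei : e i = ap - an.
  apply: (has_mean_unique (fe i iJ')); apply: has_mean_ext (has_meanB hp hn) => w.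
  by rewrite fpn.
rewrite big_cons ei mulrBl; apply: has_mean_ext (has_meanB hpJ hnJ) => w.
by rewrite big_cons fpn mulrBl.
Qed.

End Independence.

Section Moments.
Context d (T : measurableType d) (R : realType) (P : probability T R).
Variables (I : eqType) (i0 : I) (X : I -> {RV P >-> R}) (K : nat).
Hypothesis iX : mutually_independent P (fun i => X i : T -> R).
Hypothesis dX : identically_distributed P (fun i => X i : T -> R) (X i0).
Hypothesis finX : (\int[P]_w (`|X i0 w| ^+ K)%:E < +oo)%E.

Definition moment_of (j : nat) : R := fine (\int[P]_w (X i0 w ^+ j)%:E).

Let integral_id (f : R -> \bar R) i : measurable_fun setT f -> (forall x, 0 <= f x)%E ->
  (\int[P]_w f (X i w) = \int[P]_w f (X i0 w))%E.
Proof.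
move=> mf f0.
have := ge0_integral_distribution (X i) mf f0.
have := ge0_integral_distribution (X i0) mf f0.
rewrite /comp /= => <- <-; apply: eq_measure_integral => A mA _; exact: dX.
Qed.

(** Every power up to [K] is dominated by [1 + |X|^K]. *)
Lemma moment_integrable i j : (j <= K)%N ->
  P.-integrable setT (EFin \o (fun w => X i w ^+ j)).
Proof.
move=> jK; have mXj : measurable_fun setT (fun w => X i w ^+ j) by exact: measurable_funX.
have h2 : P.-integrable setT (EFin \o (fun w => `|X i w| ^+ K)).
  apply/integrableP; split.
    by apply/measurable_EFinP; apply: measurable_funX; exact: measurableT_comp.
  under eq_integral do rewrite /= ger0_norm ?exprn_ge0 //.
  rewrite (integral_id (f := fun x => (`|x| ^+ K)%:E)) //.
    by apply/measurable_EFinP; apply: measurable_funX; exact: normr_measurable.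
have iK : P.-integrable setT (EFin \o (fun w => 1 + `|X i w| ^+ K)).
  have [h1 _] := has_mean_cst P 1; exact: (integrableD measurableT h1 h2).
apply: (le_integrable measurableT _ _ iK); first exact/measurable_EFinP.
move=> w _ /=; rewrite lee_fin normrX [leRHS]ger0_norm ?addr_ge0 ?exprn_ge0 //.
have [le1|gt1] := leP `|X i w| 1.
  by apply: (@le_trans _ _ 1); [exact: exprn_ile1|rewrite lerDl exprn_ge0].
by apply: (@le_trans _ _ (`|X i w| ^+ K)); [exact: ler_weXn2l (ltW gt1) _ _ jK|rewrite lerDr].
Qed.

Lemma has_mean_moment i j : (j <= K)%N -> has_mean P (fun w => X i w ^+ j) (moment_of j).
Proof.
move=> jK; have := integrable_has_mean (moment_integrable i jK).
rewrite (_ : (\int[P]_w (X i w ^+ j)%:E = \int[P]_w (X i0 w ^+ j)%:E)%E) //.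
have mf : measurable_fun setT (fun x : R => (x ^+ j)%:E).
  by apply/measurable_EFinP; exact: measurable_funX.
have := @integral_distribution _ _ _ _ _ P (X i) _ mf (moment_integrable i jK).
have := @integral_distribution _ _ _ _ _ P (X i0) _ mf (moment_integrable i0 jK).
rewrite /comp /= => <- <-; apply: eq_measure_integral => A mA _; exact: dX.
Qed.

Lemma has_mean_prod (es : seq I) : (size es <= K)%N ->
  has_mean P (fun w => \prod_(e <- es) X e w)
    (\prod_(e <- undup es) moment_of (count_mem e es)).
Proof.
move=> sK.
have mX e : measurable_fun setT (X e : T -> R) by [].
have H := @indep_prod _ _ _ P _ (fun i => X i : T -> R) mX iX (undup es) [::]
  (fun e x => x ^+ count_mem e es) (fun e => moment_of (count_mem e es)).
rewrite cats0 undup_uniq in H; apply: has_mean_ext (H isT _ _ _) => //.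
- by move=> w; rewrite prodr_undup_exp_count.
- move=> e _; apply: has_mean_moment; apply: leq_trans sK; exact: count_size.
Qed.

End Moments.

(** * Expected traces *)

Section GramMoments.
Context d (T : measurableType d) (R : realType) (P : probability T R).
Variables (X : nat * nat -> {RV P >-> R}) (l : nat) (mom : nat -> R) (p n : nat).
Hypothesis l0 : (0 < l)%N.
Hypothesis mean_prod : forall es : seq (nat * nat), (size es <= 2 * l)%N ->
  has_mean P (fun w => \prod_(e <- es) X e w) (moment_prod mom es).

Definition entries (w : T) : 'M[R]_(p, n) :=
  \matrix_(i < p, j < n) (fun e => X e w) (nat_of_ord i, nat_of_ord j).

Let t k w := tr_gram (entries w) k.

Let has_mean_half (f : T -> R) a : has_mean P (fun w => 2 * f w) a -> has_mean P f (a / 2).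
Proof.
move=> /(has_meanZ 2^-1); rewrite mulrC; apply: has_mean_ext => w.
by rewrite mulrA mulVf ?mul1r ?pnatr_eq0.
Qed.

(** Only existence is wanted: the values enter later through [mean_spike] and the cases
    [k = 0, 1]. *)
Lemma has_mean_gram k : (k <= l)%N -> exists M, has_mean P (t k) M.
Proof.
case: k => [|k] kl.
  exists p%:R; apply: has_mean_ext (has_mean_cst P p%:R) => w.
  by rewrite /t /tr_gram expr0 mxtrace1.
exists ((\sum_(x : {ffun 'I_(2 * k).+2 -> 'I_(p + n)}) (alternating x)%:R
   * moment_prod mom (map (step_edge x) (enum 'I_(2 * k).+2))) / 2).
apply: has_mean_half; apply: has_mean_ext (_ : has_mean P (fun w =>
  \sum_(x : {ffun 'I_(2 * k).+2 -> 'I_(p + n)}) (alternating x)%:R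
   * \prod_(e <- map (step_edge x) (enum 'I_(2 * k).+2)) X e w) _) => [w|].
  rewrite tr_gram_bip (_ : (2 * k.+1 = (2 * k).+2)%N); last by lia.
  rewrite mxtrace_pow_sum; apply: eq_bigr => x _; rewrite big_map big_enum /=.
  have [/forallP ax|] := boolP (alternating x).
    by rewrite mul1r; apply: eq_bigr => s _; rewrite bip_mx_edge ax mul1r.
  rewrite negb_forall => /existsP[s /negPf ns]; rewrite mul0r (bigD1 s) //=.
  by rewrite bip_mx_edge ns !mul0r.
apply: has_mean_sum => x _; apply: has_meanZ; apply: mean_prod.
by rewrite size_map size_enum_ord; lia.
Qed.

Lemma has_mean_gram1 : mom 2%N = 1 -> has_mean P (t 1) (p * n)%:R.
Proof.
move=> m2.
rewrite (_ : (p * n)%:R = \sum_(i < p) \sum_(j < n) 1 :> R); last first.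
  by rewrite !sumr_const !card_ord -mulrnA mulnC.
apply: has_mean_ext (_ : has_mean P (fun w => \sum_(i < p) \sum_(j < n)
   \prod_(e <- [:: (nat_of_ord i, nat_of_ord j); (nat_of_ord i, nat_of_ord j)]) X e w) _) => [w|].
  rewrite /t /tr_gram expr1 /mxtrace; apply: eq_bigr => i _; rewrite mxE.
  by apply: eq_bigr => j _; rewrite !mxE big_cons big_seq1.
apply: has_mean_sum => i _; apply: has_mean_sum => j _.
have := mean_prod (es := [:: (nat_of_ord i, nat_of_ord j); (nat_of_ord i, nat_of_ord j)]).
rewrite /moment_prod /= inE eqxx /= big_seq1 /= eqxx /= m2; apply; lia.
Qed.

Lemma has_mean_cheb (M : nat -> R) : (forall k, (k <= l)%N -> has_mean P (t k) (M k)) ->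
  forall m k, (m + k <= l)%N ->
  has_mean P (fun w => cheb n%:R p%:R (tr_gram (entries w)) m k) (cheb n%:R p%:R M m k).
Proof.
move=> HM m; suff : (forall k, (m + k <= l)%N ->
    has_mean P (fun w => cheb n%:R p%:R (tr_gram (entries w)) m k) (cheb n%:R p%:R M m k)) /\
  (forall k, (m.+1 + k <= l)%N ->
    has_mean P (fun w => cheb n%:R p%:R (tr_gram (entries w)) m.+1 k)
      (cheb n%:R p%:R M m.+1 k)) by case.
elim: m => [|m [IH1 IH2]]; split=> // k kl.
- by apply: has_meanZ; apply: HM.
- apply: has_meanB; first by apply: HM; lia.
  by apply: has_meanZ; apply: HM; lia.
- apply: has_mean_ext (fun w => esym (chebSS _ _ _ m k)) _; rewrite chebSS.
  apply: has_meanB; [apply: has_meanB|]; first by apply: IH2; lia.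
    by apply: has_meanZ; apply: IH2; lia.
  by apply: has_meanZ; apply: IH1; lia.
Qed.

(** The two sides are the mean of one random variable, computed through [T_m] and through walks with
    selected spikes. *)
Lemma mean_spike i (M : nat -> R) : (i.+2 <= l)%N ->
  (forall k, (k <= l)%N -> has_mean P (t k) (M k)) ->
  2 * (cheb n%:R p%:R M i.+2 0 + (n%:R - p%:R) * (- p%:R) ^+ i.+2) =
  \sum_(x : {ffun 'I_(2 * i.+1).+2 -> 'I_(p + n)} | alternating x) walk_wt mom x.
Proof.
move=> il HM.
apply: (@has_mean_unique _ _ _ P (fun w => 2 * (cheb n%:R p%:R (tr_gram (entries w)) i.+2 0
   + (n%:R - p%:R) * (- p%:R) ^+ i.+2))).
  apply: has_meanZ; apply: has_meanD (has_mean_cst P _).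
  by apply: has_mean_cheb => //; rewrite addn0.
rewrite big_mkcond /=.
apply: has_mean_ext (_ : has_mean P (fun w =>
  \sum_(x : {ffun 'I_(2 * i.+1).+2 -> 'I_(p + n)}) \sum_(b : {ffun 'I_(2 * i.+1).+2 -> bool})
    (alternating x)%:R * (spike_coef R b x * \prod_(e <- free_edges b x) X e w)) _) => [w|].
  transitivity (\tr (spike_mx (bip_mx (entries w)) (@opp_side p n) ^+ (2 * i.+2))); last first.
    by rewrite mxtrace_spike_bip.
  rewrite (_ : (2 * i.+2 = (2 * i.+1).+2)%N); last by lia.
  rewrite -mxtrace_spike; apply: eq_bigr => x _; apply: eq_bigr => b _.
  by rewrite -prod_spike_wt.
apply: has_mean_sum => x _.
rewrite (_ : (if alternating x then walk_wt mom x else 0) =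
  \sum_(b : {ffun 'I_(2 * i.+1).+2 -> bool}) (alternating x)%:R
     * (spike_coef R b x * moment_prod mom (free_edges b x))); last first.
  by rewrite -mulr_sumr; case: ifP => _; rewrite ?mul1r ?mul0r.
apply: has_mean_sum => b _; do 2 apply: has_meanZ; apply: mean_prod.
rewrite size_map; apply: leq_trans (_ : (2 * i.+1).+2 <= _)%N; last by lia.
by rewrite -[leqRHS](size_enum_ord) size_filter count_size.
Qed.

End GramMoments.

Lemma mx_scale_exp (R : comNzRingType) (q : nat) (c : R) (A : 'M[R]_q) (l : nat) :
  (c *: A) ^+ l = c ^+ l *: A ^+ l.
Proof.
elim: l => [|l IH]; first by rewrite !expr0 scale1r.
by rewrite !exprS IH -mxscaleAl -mxscaleAr scalerA.
Qed.

Unset Implicit Arguments.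

Theorem theorem1 (d : measure_display) (T : measurableType d) (R : realType)
    (P : probability T R) (Y : nat -> nat -> {RV P >-> R}) (l : nat) :
  mutually_independent P (fun ij : nat * nat => (Y ij.1 ij.2 : T -> R)) ->
  identically_distributed P (fun ij : nat * nat => (Y ij.1 ij.2 : T -> R))
    (Y 0%N 0%N) ->
  (\int[P]_w (Y 0%N 0%N w)%:E = 0)%E ->
  (\int[P]_w ((Y 0%N 0%N w) ^+ 2)%:E = 1)%E ->
  (0 < l)%N ->
  (\int[P]_w (`|Y 0%N 0%N w| ^+ (2 * l))%:E < +oo)%E ->
  let m4 : R := fine (\int[P]_w ((Y 0%N 0%N w) ^+ 4)%:E) in
  exists C : R, forall p n : nat, (0 < n)%N -> (p <= n)%N ->
    exists r : R,
      (\int[P]_w (trSl (fun i j => (Y i j : T -> R)) p n l w)%:E = r%:E)%E /\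
      `| r - \sum_(1 <= b < (minn l p).+1)
            ( ('C(p, b) * 'C(n - b, l.+1 - b))%:R / n%:R ^+ l
                * (l`! * 'C(l.-1, b.-1))%:R
            + ('C(p, b) * 'C(n - b, l - b))%:R / n%:R ^+ l
                * ( (b`! * (l - b)`!)%:R / 2
                      * ('C(2 * l, 2 * b) + (2 * b - 1) * 'C(l, b) ^ 2)%:R
                  + (m4 - 3) * (b < l)%:R
                      * (b`! * (l - b)`! * 'C(l, b.-1) * 'C(l, b.+1))%:R ) ) |
      <= C * \sum_(1 <= b < (minn l p).+1) (p%:R ^+ b / n%:R ^+ b.+1).
Proof.
move=> iY dY mean0 var1 l0 fin2l m4.
pose X (e : nat * nat) : {RV P >-> R} := Y e.1 e.2.
pose mom := moment_of (0%N, 0%N) X.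
have mean_prod es : (size es <= 2 * l)%N ->
    has_mean P (fun w => \prod_(e <- es) X e w) (moment_prod mom es).
  exact: (@has_mean_prod _ _ _ P _ (0%N, 0%N) X _ iY dY fin2l es).
have m0 : mom 0%N = 1.
  have [_ h] := has_mean_cst P (1 : R).
  by rewrite /mom /moment_of (_ : (\int[P]_w _)%E = 1%E).
have m1 : mom 1%N = 0 by rewrite /mom /moment_of /X /= mean0.
have m2 : mom 2%N = 1 by rewrite /mom /moment_of /X /= var1.
have [K1 K10 H1] := moment_expansion m0 m1 m2 l0.
have [K2 K20 H2] := main_term_expansion m4 l0.
exists (K1 + K2) => p n n0 pn.
have [p0|p_gt0] := posnP p.
  exists 0; rewrite p0 minn0 !big_nil subrr normr0 mulr0; split=> //.
  rewrite (eq_integral (cst 0%E)) ?integral_cst ?mul0e // => w _.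
  by rewrite /trSl /mxtrace big_ord0.
have nR : (n%:R : R) != 0 by rewrite pnatr_eq0 -lt0n.
have np : 0 < (n%:R : R) by rewrite ltr0n.
(* Beyond [l] the mean may fail to exist, and [M] gets the default 0. *)
have /choice[M HM] : forall k, exists M, (k <= l)%N -> has_mean P (fun w => tr_gram (entries X p n w) k) M.
  move=> k; case: (leqP k l) => kl; last by exists 0.
  by have [M hM] := has_mean_gram p n l0 mean_prod kl; exists M.
have M0 : M 0%N = p%:R.
  apply: (has_mean_unique (HM 0%N (leq0n l))); apply: has_mean_ext (has_mean_cst P _) => w.
  by rewrite /tr_gram expr0 mxtrace1.
have M1 : M 1%N = (p * n)%:R.
  exact: has_mean_unique (HM 1%N l0) (has_mean_gram1 p n l0 mean_prod m2).
have {H1} H1 := H1 p n p_gt0 pn M M0 M1 (fun i il => mean_spike l0 mean_prod il HM).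
have {H2} H2 := H2 p n p_gt0 pn.
have Hn : `|M l - \sum_(i < l) main_term m4 l i.+1 p n|
    <= (K1 + K2) * (p%:R * n%:R ^+ l / n%:R ^+ 2).
  rewrite mulrDl; apply: le_trans (lerD H1 H2).
  apply: le_trans (ler_normB _ _).
  by rewrite le_eqVlt; apply/orP; left; apply/eqP; congr (`|_|); rewrite opprB addrA subrK.
exists (M l / n%:R ^+ l); split.
  have [_] := has_meanZ (n%:R ^- l) (HM l (leqnn l)); rewrite mulrC => <-.
  apply: eq_integral => w _; congr EFin.
  rewrite /trSl /Smat mx_scale_exp mxtraceZ exprVn /tr_gram; congr (_ * \tr ((_ *m _^T) ^+ _));
    by apply/matrixP => i j; rewrite !mxE.
(* The terms with [p < b <= l] may be added because ['C(p, b)] is zero. *)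
rewrite (_ : \sum_(1 <= b < _) _ = (\sum_(i < l) main_term m4 l i.+1 p n) / n%:R ^+ l); last first.
  transitivity (\sum_(1 <= b < (minn l p).+1) main_term m4 l b p n / n%:R ^+ l).
    by apply: eq_bigr => b _; rewrite /main_term; ring.
  rewrite mulr_suml -(big_mkord xpredT (fun i => main_term m4 l i.+1 p n / n%:R ^+ l)).
  rewrite big_add1 /= [RHS](big_cat_nat (leq0n _) (geq_minl l p)) /=.
  rewrite [X in _ = _ + X]big_nat [X in _ = _ + X]big1 ?addr0 // => i /andP[+ il].
  rewrite geq_min.
  case/orP; first by rewrite leqNgt il.
  by move=> pi; rewrite /main_term bin_small // !mul0n !mul0r add0r mul0r.
rewrite -mulrBl normrM (ger0_norm (_ : 0 <= n%:R ^- l)); last by rewrite invr_ge0 exprn_ge0.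
(* The bound is the single term [b = 1] of the error sum, and the other terms are nonnegative. *)
apply: (@le_trans _ _ ((K1 + K2) * (p%:R / n%:R ^+ 2))).
  rewrite ler_pdivrMr ?exprn_gt0 //; apply: le_trans Hn _.
  by rewrite le_eqVlt; apply/orP; left; apply/eqP; ring.
apply: ler_wpM2l; first exact: addr_ge0.
rewrite big_ltn; last by rewrite ltnS leq_min l0.
by rewrite expr1 lerDl; apply: sumr_ge0 => b _; rewrite divr_ge0 ?exprn_ge0.
Qed.
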